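(* Consider the ON/OFF channel model with $N$ links under the Longest Connected Queue (LCQ, max-weight) policy, with all arrival processes $A_i(t)$ and channel processes $S_i(t)$ independent and i.i.d. over slots. Assume that $\boldsymbol{\lambda}\in\rho\Lambda$ for some $\rho$ with $0<\rho<1$. Let $K$ be any positive integer such that $r_{K+1}>\lambda_{tot}$, that is, $$1-(1-p_{min})^{K+1}>\lambda_{tot}.$$ Then the LCQ policy stabilizes all queues (every queue is strongly stable) and $$\sum_{i=1}^N\overline{Q}_i\le\frac{K B_\theta C}{(1-\rho)^2},$$ where $$\theta=\begin{cases}\dfrac{(1-\rho)(\mu_K^{sym}-\mu_N^{sym})}{r_{K+1}} & \text{if }K<N\\[2mm] 0&\text{if }K\ge N,\end{cases}\qquad C=\begin{cases}\dfrac{r_{K+1}}{\dfrac{r_N K\lambda_{tot}}{N(1-\rho)}+\dfrac{r_K(r_{K+1}-\lambda_{tot})}{1-\rho}}&\text{if }K<N\\[4mm] 1/r_N&\text{if }K\ge N,\end{cases}$$ $$B_\theta=\frac{\lambda_{tot}}{2}+\frac12\sum_{i=1}^N\mathbb{E}\{A_i(t)^2\}-\sum_{i=1}^N\lambda_i^2+\frac{\theta}{2}\left[\mathbb{E}\{A_{tot}(t)^2\}+\lambda_{tot}-2\lambda_{tot}^2\right].$$ Consequently the average delay $\overline{W}$ satisfies $$\overline{W}\le\min\left[\frac{K B_\theta C}{\lambda_{tot}(1-\rho)^2},\ \frac{N B_0}{\lambda_{tot}r_N(1-\rho)}\right],$$ where $B_0$ is the value of $B_\theta$ with $\theta=0$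.
   Context: ON/OFF channel model: there are $N$ links (queues) and slotted time $t\in\{0,1,2,\ldots\}$. $A_i(t)$ is the (non-negative integer) number of packets arriving to queue $i$ on slot $t$; the processes $A_i(t)$ are mutually independent over $i$, each i.i.d. over slots, with mean $\lambda_i=\mathbb{E}\{A_i(t)\}$ and $\mathbb{E}\{A_i(t)^2\}<\infty$. $S_i(t)\in\{0,1\}$ is the channel state of link $i$; the processes $S_i(t)$ are mutually independent over $i$, i.i.d. over slots, with $\Pr[S_i(t)=1]=p_i$, and independent of the arrivals. Each slot at most one link is selected; $\mu_i(t)=S_i(t)$ if link $i$ is selected on slot $t$ and $\mu_i(t)=0$ otherwise. Queue backlogs evolve as $Q_i(t+1)=\max[Q_i(t)-\mu_i(t),0]+A_i(t)$. The initial backlogs $Q_i(0)$ are non-negative integers with finite second moment, independent of the arrival and channel processes. LCQ (max-weight) policy: each slot $t$, observe all $Q_i(t)$ and $S_i(t)$ and select a link with the largest product $Q_i(t)S_i(t)$, using a stationary probabilistic tie-breaking rule. Notation: $\boldsymbol{\lambda}=(\lambda_1,\ldots,\lambda_N)$, $\lambda_{tot}=\sum_{i=1}^N\lambda_i$ (positive where it appears in a denominator), $A_{tot}(t)=\sum_{i=1}^N A_i(t)$, $p_{min}=\min_i p_i$ with $0<p_{min}<1$. For positive integers $k$: $r_k=1-(1-p_{min})^k$ and $\mu_k^{sym}=r_k/k$. Capacity region $\Lambda$: the closure of the set of arrival rate vectors for which some control algorithm strongly stabilizes all queues; it is known to equal the set of non-negative vectors $\boldsymbol{\lambda}$ with $\sum_{i\in\mathcal{L}}\lambda_i\le1-\prod_{i\in\mathcal{L}}(1-p_i)$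 for every non-empty $\mathcal{L}\subseteq\{1,\ldots,N\}$. $\rho\Lambda=\{\rho x:x\in\Lambda\}$. A queue is strongly stable if $\limsup_{t\to\infty}\frac1t\sum_{\tau=0}^{t-1}\mathbb{E}\{Q_i(\tau)\}<\infty$. $\overline{Q}_i$ is the time average backlog $\lim_{t\to\infty}\frac1t\sum_{\tau=0}^{t-1}\mathbb{E}\{Q_i(\tau)\}$ (the system is a Markov chain for which these time averages are well defined under LCQ for rates interior to $\Lambda$). The average delay is, by Little's Theorem, $\overline{W}=\frac{1}{\lambda_{tot}}\sum_{i=1}^N\overline{Q}_i$. *)

(* Defs.v *)
From HB Require Import structures.
From mathcomp Require Import all_boot all_order all_algebra.
From mathcomp Require Import all_classical all_reals all_analysis.

Set Implicit Arguments.
Unset Strict Implicit.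
Unset Printing Implicit Defensive.

Import Order.TTheory GRing.Theory Num.Theory.
Import numFieldNormedType.Exports.

Local Open Scope classical_set_scope.
Local Open Scope ring_scope.

(* Mutual independence: the product rule for every finite subfamily, listed
   without repetition by [j]. *)
Definition mutually_independent d (T : measurableType d) (R : realType)
    (P : probability T R) (I : Type) (F : I -> set (set T)) : Prop :=
  forall (n : nat) (j : 'I_n -> I) (E : 'I_n -> set T),
    injective j -> (forall k, F (j k) (E k)) ->
    P (\bigcap_k E k) = (\prod_(k < n) P (E k))%E.

Definition identically_distributed d (T : measurableType d) (R : realType)
    (P : probability T R) d' (T' : measurableType d')
    (Y : nat -> {RV P >-> T'}) : Prop :=
  forall t B, measurable B ->
    distribution P (Y t) B = distribution P (Y 0%N) B.

(* [rnd] is auxiliary randomness, used by the tie-breaking rule. *)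
Record onoff_processes d (T : measurableType d) (R : realType)
    (P : probability T R) (N : nat) := OnOffProcesses {
  arr : 'I_N -> nat -> {RV P >-> nat};
  chan : 'I_N -> nat -> {RV P >-> bool};
  rnd : nat -> {RV P >-> R};
  init : 'I_N -> {RV P >-> nat}
}.

Inductive source (N : nat) : Type :=
| Arr of 'I_N & nat
| Chan of 'I_N & nat
| Rnd of nat
| Init.
Arguments Init {N}.

Section Model.
Context d (T : measurableType d) (R : realType) (P : probability T R) (N : nat).
Implicit Types (X : onoff_processes P N) (sel : nat -> T -> option 'I_N).
Implicit Types (lam : 'rV[R]_N) (p : 'I_N -> R).

(* The sigma-algebra of each source. The initial backlogs form one source, as
   they may depend on each other; the vector takes countably many values, so
   every set of values is admitted. *)
Definition source_events X (s : source N) : set (set T) :=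
  match s with
  | Arr i t => [set E | exists B : set nat, E = arr X i t @^-1` B]
  | Chan i t => [set E | exists B : set bool, E = chan X i t @^-1` B]
  | Rnd t => [set E | exists2 B : set R, measurable B & E = rnd X t @^-1` B]
  | Init => [set E | exists B : set {ffun 'I_N -> nat},
                       E = (fun w => [ffun i => init X i w]) @^-1` B]
  end.

Record onoff_model X lam p : Prop := OnOffModel {
  sources_independent : mutually_independent P (source_events X);
  arr_identical : forall i, identically_distributed (arr X i);
  arr_mean : forall i t,
    ('E_P[fun w => (arr X i t w)%:R%R] = (lam ord0 i)%:E)%E;
  arr_square : forall i t,
    ('E_P[fun w => ((arr X i t w)%:R ^+ 2)%R] < +oo)%E;
  chan_prob : forall i t, P [set w | chan X i t w] = (p i)%:E;
  rnd_identical : identically_distributed (rnd X);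
  init_square : forall i, ('E_P[fun w => ((init X i w)%:R ^+ 2)%R] < +oo)%E
}.

(* [sel t w] is the link selected on slot [t], if any; subtraction truncates. *)
Fixpoint backlog X sel (i : 'I_N) (t : nat) (w : T) : nat :=
  match t with
  | 0 => init X i w
  | t'.+1 => (backlog X sel i t' w
                - ((sel t' w == Some i) && chan X i t' w)
              + arr X i t' w)%N
  end.

Definition avg_backlog X sel (i : 'I_N) (t : nat) : \bar R :=
  ((t%:R^-1)%:E
     * \sum_(0 <= tau < t) 'E_P[fun w => (backlog X sel i tau w)%:R%R])%E.

Definition strongly_stable X sel (i : 'I_N) : Prop :=
  (limn_esup (avg_backlog X sel i) < +oo)%E.

(* Meaningful only if the averages converge: [limn] is arbitrary otherwise. *)
Definition Qbar X sel (i : 'I_N) : \bar R := limn (avg_backlog X sel i).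

Definition lam_tot lam : R := \sum_i lam ord0 i.

Definition Wbar X sel lam : \bar R :=
  (((lam_tot lam)^-1)%:E * \sum_i Qbar X sel i)%E.

(* What the controller may have observed or decided by the time the selection
   of slot [t] is made, that selection included. *)
Inductive past_event X sel (t : nat) : set T -> Prop :=
| PastInit i (B : set nat) : past_event X sel t (init X i @^-1` B)
| PastArr i tau (B : set nat) of (tau < t)%N :
    past_event X sel t (arr X i tau @^-1` B)
| PastChan i tau (B : set bool) of (tau <= t)%N :
    past_event X sel t (chan X i tau @^-1` B)
| PastSel tau (B : set (option 'I_N)) of (tau <= t)%N :
    past_event X sel t (sel tau @^-1` B).

Inductive future_event X (t : nat) : set T -> Prop :=
| FutureArr i tau (B : set nat) of (t <= tau)%N :
    future_event X t (arr X i tau @^-1` B)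
| FutureChan i tau (B : set bool) of (t < tau)%N :
    future_event X t (chan X i tau @^-1` B).

(* A possibly randomized and history dependent selection process, which does
   not anticipate the future arrivals and channel states. *)
Definition control_algorithm X sel : Prop :=
  (forall t B, measurable (sel t @^-1` B)) /\
  (forall t E F, <<s past_event X sel t >> E -> <<s future_event X t >> F ->
     P (E `&` F) = (P E * P F)%E).

Definition state_at X sel (t : nat) (w : T) : {ffun 'I_N -> nat} :=
  [ffun i => backlog X sel i t w].

Definition channel_at X (t : nat) (w : T) : {ffun 'I_N -> bool} :=
  [ffun i => chan X i t w].

(* [g q s u] is a link with the largest product q_i s_i; the i.i.d. seed [u]
   breaks ties with probabilities that depend on [q] and [s] only. *)
Definition LCQ X sel : Prop :=
  exists g : {ffun 'I_N -> nat} -> {ffun 'I_N -> bool} -> R -> 'I_N,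
    [/\ forall q s i, measurable [set u | g q s u = i],
        forall (q : {ffun 'I_N -> nat}) (s : {ffun 'I_N -> bool}) u i,
          (q i * s i <= q (g q s u) * s (g q s u))%N &
        forall t w, sel t w
          = Some (g (state_at X sel t w) (channel_at X t w) (rnd X t w))].

Definition B_ X lam (theta : R) : R :=
  lam_tot lam / 2
  + 2^-1 * \sum_i fine ('E_P[fun w => ((arr X i 0%N w)%:R ^+ 2)%R])%E
  - \sum_i lam ord0 i ^+ 2
  + theta / 2
    * (fine ('E_P[fun w => ((\sum_i arr X i 0%N w)%N%:R ^+ 2)%R])%E
       + lam_tot lam - 2 * lam_tot lam ^+ 2).

End Model.

Definition stabilizable (R : realType) (N : nat) (p : 'I_N -> R)
    (lam : 'rV[R]_N) : Prop :=
  exists (d : measure_display) (T : measurableType d) (P : probability T R)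
    (X : onoff_processes P N) (sel : nat -> T -> option 'I_N),
    [/\ onoff_model X lam p, control_algorithm X sel &
        forall i, strongly_stable X sel i].

Definition capacity_region (R : realType) (N : nat) (p : 'I_N -> R) :
    set 'rV[R]_N :=
  closure [set lam | stabilizable p lam].

Section Constants.
Context (R : realType) (N : nat).
Implicit Types (lam : 'rV[R]_N) (p : 'I_N -> R) (rho : R) (k K : nat).

(* The neutral element 1 is harmless, the [p i] being probabilities. *)
Definition pmin p : R := \big[Num.min/1]_i p i.

Definition r_ p k : R := 1 - (1 - pmin p) ^+ k.

Definition mu_sym p k : R := r_ p k / k%:R.

Definition theta_ p rho K : R :=
  if (K < N)%N
  then (1 - rho) * (mu_sym p K - mu_sym p N) / r_ p K.+1
  else 0.

Definition C_ p lam rho K : R :=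
  if (K < N)%N
  then r_ p K.+1
       / (r_ p N * K%:R * lam_tot lam / (N%:R * (1 - rho))
          + r_ p K * (r_ p K.+1 - lam_tot lam) / (1 - rho))
  else (r_ p N)^-1.

End Constants.

(* Main.v *)
From HB Require Import structures.
Require Import Defs.
From mathcomp Require Import all_boot all_order all_algebra.
From mathcomp Require Import all_classical all_reals all_analysis.
From mathcomp Require Import measurable_realfun ring lra zify.
Import Order.TTheory GRing.Theory Num.Theory.
Import numFieldNormedType.Exports.
Local Open Scope classical_set_scope.
Local Open Scope ring_scope.

Set Implicit Arguments.
Unset Strict Implicit.
Unset Printing Implicit Defensive.

(** The backlogs under the longest connected queue policy form a Markov chain
    on the vectors of natural numbers, since the selected link is a function of
    the backlogs and of the fresh randomness of the slot ([chain_markov]).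

    The bound is a drift argument. Let [q] be the backlogs and [Q] their total.
    The Lyapunov function is the sum over the queues of
    [q_i ^ 2 / 2 + (1/2 - lam_i) q_i], plus [theta] times the same expression in
    [Q]. Its one-slot drift is exactly [B_theta] minus
    [E[max q_i S_i] - sum lam_i q_i + theta Q (conn - lam_tot)], where [conn] is
    the probability that some nonempty queue is connected ([lyapunov_drift]).
    The expectation of the largest weight is the sum over [m] of the
    probability that some queue with more than [m] packets is connected.
    Summing the constraints of the capacity region over these levels
    ([level_sum_ge]) shows that this expectation dominates [sum v_i q_i] for
    every rate vector [v] that satisfies the constraints. Take
    [v = lam + (1 - rho) mu_k] on the [k] nonempty queues: the gain is at
    least [(1 - rho) mu_k Q]. When [k <= K] it is at least
    [(1 - rho) mu_K Q]; when [k > K] the term in [theta] contributes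
    [r_(K+1) - lam_tot]. The value of [theta] makes the two lower bounds equal,
    to [gain K * Q] ([level_sum_theta_gain]), and averaging the drift over the
    slots bounds the average of [Q] by [B_theta / gain K], which is the
    announced bound ([C_gain]). When [N <= K], the weight [theta] is 0, and
    the inequality [k <= N] alone gives a stronger bound.

    The constraints of the capacity region are necessary for stability because
    a set of links sends at most one packet per slot, and only when one of its
    links is connected ([stable_rate_le]).

    The time averages converge ([average_cost_cvg]) although, with second
    moments only, the drift inequality bounds the average backlogs without
    making the backlogs uniformly integrable over the slots. The empty state is
    accessible from everywhere. Let [h] be the expected backlog accumulated
    before the first visit to it. It is bounded by a Foster-Lyapunov function,
    hence finite, and it solves a Poisson equation: the sum of the expected
    backlogs up to slot [t] is [E h(0) - E h(t)] plus a constant times the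
    expected time spent at the empty state. Splitting [E h(t)] at the visits to
    the empty state bounds it by a constant plus a sum of [t] tails of a
    convergent series, which is o(t). The same identity for the constant cost 1
    gives the limit fraction of the time spent at the empty state. *)

(** * Random variables with countably many values *)

Section CountableValued.
Context d (T : measurableType d) (R : realType) (P : probability T R).
Context (S : countType).
Implicit Types (f : T -> S) (phi : S -> \bar R).
Local Open Scope ereal_scope.

(** A map into a countable type, all of whose fibers are events: a discrete
    random variable. *)
Definition discrete_rv f := forall x, measurable (f @^-1` [set x]).

Lemma bigcup_unpickle f (B : set S) :
  f @^-1` B =
  \bigcup_n (if unpickle n is Some x then
               if x \in B then f @^-1` [set x] else set0 else set0).
Proof.
apply/seteqP; split => [w /= Bw|w [n _]].
  by exists (pickle (f w)) => //; rewrite pickleK mem_set.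
case: (unpickle n) => // x; case: ifPn => //.
by rewrite inE => Bx /= ->.
Qed.

Lemma discrete_rv_preimage f (B : set S) :
  discrete_rv f -> measurable (f @^-1` B).
Proof.
move=> mf; rewrite bigcup_unpickle; apply: bigcupT_measurable => n.
by case: (unpickle n) => // x; case: ifP.
Qed.

Lemma measurable_discrete_comp d' (T' : sigmaRingType d') f (h : S -> T') :
  discrete_rv f -> measurable_fun setT (fun w => h (f w)).
Proof.
move=> mf _ B mB; rewrite setTI.
exact: (discrete_rv_preimage (h @^-1` B) mf).
Qed.

Lemma integral_fibers f (F : T -> \bar R) : discrete_rv f ->
  measurable_fun setT F -> (forall w, 0 <= F w) ->
  \int[P]_w F w = \esum_(x in [set: S]) \int[P]_(w in f @^-1` [set x]) F w.
Proof.
move=> mf mF F0.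
pose E n := (fun w => pickle (f w)) @^-1` [set n].
have EE x : E (pickle x) = f @^-1` [set x].
  apply/seteqP; split=> w; rewrite /E /=; last by move=> ->.
  exact: (pcan_inj (@pickleK S)).
have mE n : measurable (E n).
  exact: (discrete_rv_preimage [set x | pickle x = n] mf).
have ET : [set: T] = \bigcup_n E n.
  by apply/seteqP; split => // w _; exists (pickle (f w)).
rewrite ET ge0_integral_bigcup //; first last.
- by move=> i j _ _ [w [<- <-]].
- by apply: measurable_funTS.
rewrite nneseries_esumT; last by move=> n; apply: integral_ge0.
have pI : set_inj [set: S] pickle by move=> x y _ _; exact: (pcan_inj (@pickleK S)).
transitivity (\esum_(n in pickle @` [set: S]) \int[P]_(w in E n) F w).
  rewrite esum_mkcond [RHS]esum_mkcond; apply: eq_esum => n _.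
  rewrite in_setT; case: ifPn => //; rewrite notin_setE => nE.
  rewrite (_ : E n = set0) ?integral_set0 //.
  by apply/seteqP; split => // w /= En; apply: nE; exists (f w).
rewrite (esum_image _ _ _ pI); apply: eq_esum => x _.
by rewrite EE.
Qed.

(** The law of the unconscious statistician. *)
Lemma integral_discrete f phi : discrete_rv f -> (forall x, 0 <= phi x) ->
  \int[P]_w phi (f w)
  = \esum_(x in [set: S]) (phi x * P (f @^-1` [set x])).
Proof.
move=> mf phi0; rewrite (integral_fibers mf) //.
  apply: eq_esum => x _; rewrite -(integral_cst P (mf x)).
  by apply: eq_integral => w; rewrite inE /= => ->.
exact: measurable_discrete_comp.
Qed.

Lemma probability_fibers f (A : set T) : discrete_rv f -> measurable A ->
  P A = \esum_(x in [set: S]) P (A `&` f @^-1` [set x]).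
Proof.
move=> mf mA.
have mI x : measurable (f @^-1` [set x] `&` A) by exact: measurableI.
rewrite -(setIT A) -integral_indic // (integral_fibers mf) //.
  by apply: eq_esum => x _; rewrite integral_indic // setIT.
by apply/measurable_EFinP; exact: measurable_indic.
Qed.

End CountableValued.

Section DiscretePair.
Context d (T : measurableType d) (R : realType) (P : probability T R).
Local Open Scope ereal_scope.

Lemma discrete_rv_comp (S S' : countType) (f : T -> S) (h : S -> S') :
  discrete_rv f -> discrete_rv (fun w => h (f w)).
Proof. by move=> mf x; exact: (discrete_rv_preimage [set y | h y = x] mf). Qed.

Lemma discrete_rv_pair (S S' : countType) (f : T -> S) (f' : T -> S') :
  discrete_rv f -> discrete_rv f' -> discrete_rv (fun w => (f w, f' w)).
Proof.
move=> mf mf' [x y].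
rewrite (_ : _ @^-1` _ = f @^-1` [set x] `&` f' @^-1` [set y]).
  exact: measurableI.
by apply/seteqP; split=> w /= [-> ->].
Qed.

Lemma esumZl (S : choiceType) (c : R) (a : S -> \bar R) :
  (0 <= c)%R -> (forall x, 0 <= a x) ->
  \esum_(x in [set: S]) (c%:E * a x) = c%:E * \esum_(x in [set: S]) a x.
Proof.
move=> c0 a0; rewrite -ereal_supZl //; last first.
  by apply/set0P; exists (\sum_(i \in set0) a i); exists set0 => //; exact: fsets_set0.
rewrite image_comp; congr ereal_sup; apply: eq_imagel => X [finX _] /=.
by rewrite ge0_mule_fsumr.
Qed.

End DiscretePair.

(** * Time averages of a positive recurrent countable Markov chain *)

Section Expectation.
Context d (T : measurableType d) (R : realType) (P : probability T R).
Context (S : countType).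
Implicit Types (f : T -> S) (phi psi : S -> \bar R).
Local Open Scope ereal_scope.

(** The expectation of a nonnegative function of a discrete random variable. *)
Definition expect f phi := \int[P]_w phi (f w).

Lemma expect_ge0 f phi : (forall x, 0 <= phi x) -> 0 <= expect f phi.
Proof. by move=> phi0; apply: integral_ge0 => w _. Qed.

Lemma expectD f phi psi : discrete_rv f ->
  (forall x, 0 <= phi x) -> (forall x, 0 <= psi x) ->
  expect f (fun x => phi x + psi x) = expect f phi + expect f psi.
Proof.
move=> mf phi0 psi0; rewrite /expect ge0_integralD //; exact: measurable_discrete_comp.
Qed.

Lemma expectZ f phi (c : \bar R) : discrete_rv f -> (forall x, 0 <= phi x) ->
  0 <= c -> expect f (fun x => c * phi x) = c * expect f phi.
Proof.
move=> mf phi0 c0; rewrite /expect ge0_integralZl //; exact: measurable_discrete_comp.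
Qed.

Lemma expect_le f phi psi : discrete_rv f -> (forall x, 0 <= phi x) ->
  (forall x, phi x <= psi x) -> expect f phi <= expect f psi.
Proof.
move=> mf phi0 le; apply: ge0_le_integral => //; exact: measurable_discrete_comp.
Qed.

Lemma expect_cst f (c : \bar R) : expect f (fun=> c) = c.
Proof.
rewrite /expect (integral_cst P measurableT).
by rewrite -[RHS]mule1; congr (_ * _); exact: probability_setT.
Qed.

Lemma expect_series f (u : nat -> S -> \bar R) : discrete_rv f ->
  (forall n x, 0 <= u n x) ->
  expect f (fun x => \sum_(n <oo) u n x) = \sum_(n <oo) expect f (u n).
Proof.
move=> mf u0; rewrite /expect integral_nneseries // => n.
exact: measurable_discrete_comp.
Qed.

End Expectation.

Section ErgodicAverages.
Context d (T : measurableType d) (R : realType) (P : probability T R).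
Context (S : countType) (Y : S -> T -> S) (Q : nat -> T -> S) (z : S).
Hypothesis mY : forall q, discrete_rv (Y q).
Hypothesis mQ : forall t, discrete_rv (Q t).
Local Open Scope ereal_scope.

(** The transition operator of the chain that moves from [q] to [Y q]. *)
Definition transition (phi : S -> \bar R) (q : S) := expect P (Y q) phi.
Local Notation K := transition.
Local Notation E t phi := (expect P (Q t) phi).

Hypothesis markov : forall t phi, (forall x, 0 <= phi x) ->
  E t.+1 phi = E t (K phi).

(** [phi], killed at [z]. *)
Definition off (phi : S -> \bar R) (x : S) := if x == z then 0 else phi x.

(** The expected cost [f] of slot [n], on the event that the chain has not
    visited [z] up to that slot, included. *)
Fixpoint taboo (f : S -> \bar R) (n : nat) : S -> \bar R :=
  if n is n'.+1 then off (K (taboo f n')) else off f.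

(** The expected cost [f] accumulated from slot [n] on, before the first visit
    to [z]. For [n = 0] this is a solution of the Poisson equation. *)
Definition taboo_tail (f : S -> \bar R) (n : nat) (x : S) :=
  \sum_(n <= k <oo) taboo f k x.

Let K_ge0 phi : (forall x, 0 <= phi x) -> forall q, 0 <= K phi q.
Proof. by move=> phi0 q; exact: expect_ge0. Qed.

Let off_ge0 phi : (forall x, 0 <= phi x) -> forall q, 0 <= off phi q.
Proof. by move=> phi0 q; rewrite /off; case: ifP. Qed.

Section Cost.
Variables (f H : S -> \bar R).
Hypothesis f0 : forall x, 0 <= f x.
Hypothesis H0 : forall x, 0 <= H x.
(* A Foster-Lyapunov function. *)
Hypothesis fH : forall x, x != z -> f x + K H x <= H x.
Hypothesis HQ : E 0 H < +oo.
Hypothesis Hz : K H z < +oo.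
Hypothesis fz : f z < +oo.

Let taboo_ge0 n x : 0 <= taboo f n x.
Proof.
by elim: n x => [|n IH] x /=; apply: off_ge0 => // y; exact: K_ge0.
Qed.

Let tail_ge0 n x : 0 <= taboo_tail f n x.
Proof. by apply: nneseries_ge0. Qed.

Let tail_shift n x : taboo_tail f n x = \sum_(k <oo) taboo f (k + n) x.
Proof. by rewrite /taboo_tail -nneseries_addn. Qed.

Lemma taboo_partial_sum_le n x : \sum_(0 <= k < n) taboo f k x <= H x.
Proof.
elim: n x => [|n IH] x; first by rewrite big_geq.
rewrite big_nat_recl //= /off; have [->|xz] := eqVneq x z.
  by rewrite add0e big1.
apply: le_trans (fH xz); apply: leeD => //.
rewrite /K /expect -ge0_integral_sum //.
- apply: ge0_le_integral => //.
  + by move=> w _; apply: sume_ge0.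
  + exact: (measurable_discrete_comp (fun y => \sum_(0 <= k < n) taboo f k y)).
  + exact: measurable_discrete_comp.
  + by move=> k; exact: measurable_discrete_comp.
Qed.

Lemma taboo_tail0_le x : taboo_tail f 0 x <= H x.
Proof.
apply: lime_le; first exact: is_cvg_nneseries.
by apply: nearW => n; exact: taboo_partial_sum_le.
Qed.

(* [c] is the expected cost of a cycle from [z] to [z]; the [u n] are the tails
   of that expectation, and tend to 0 because it is finite. *)
Let u n := K (taboo_tail f n) z.
Let c := f z + u 0.
Let one_z (x : S) : \bar R := if x == z then 1 else 0.

Let one_z_ge0 x : 0 <= one_z x.
Proof. by rewrite /one_z; case: ifP. Qed.

Let uE n : u n = \sum_(n <= k <oo) K (taboo f k) z.
Proof.
rewrite /u /K -nneseries_addn; last by move=> k; apply: expect_ge0.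
rewrite -expect_series //; by apply: eq_integral => w _; rewrite tail_shift.
Qed.

Let u_ge0 n : 0 <= u n.
Proof. exact: expect_ge0. Qed.

Let u0_fin : u 0 < +oo.
Proof. by apply: le_lt_trans Hz; apply: expect_le => //; exact: taboo_tail0_le. Qed.

Let u_cvg0 : u @ \oo --> 0.
Proof.
rewrite (_ : u = fun n => \sum_(n <= k <oo) K (taboo f k) z).
  apply: nneseries_tail_cvg; first by rewrite -uE.
  by move=> k _; exact: expect_ge0.
by apply/funext => n; exact: uE.
Qed.

Let u_fin n : u n \is a fin_num.
Proof.
rewrite ge0_fin_numE //; apply: le_lt_trans u0_fin.
rewrite !uE [leRHS](nneseries_split 0 n) ?add0n.
  by apply: leeDr; apply: sume_ge0 => k _; exact: expect_ge0.
by move=> k _; exact: expect_ge0.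
Qed.

Lemma taboo_tail_transition n x :
  K (taboo_tail f n) x = taboo_tail f n.+1 x + u n * one_z x.
Proof.
rewrite /one_z; have [->|xz] := eqVneq x z.
  rewrite mule1 /taboo_tail -nneseries_addn // eseries0 ?add0e //.
  by move=> k _ _; rewrite addnS /= /off eqxx.
rewrite mule0 adde0 /taboo_tail -[RHS]nneseries_addn //.
transitivity (\sum_(k <oo) K (taboo f (k + n)) x).
  rewrite /K -expect_series //; apply: eq_integral => w _.
  exact: tail_shift.
by apply: eq_eseriesr => k _; rewrite addnS /= /off (negbTE xz).
Qed.

(** The Poisson equation: it is what makes the sum of the expected costs
    telescope, see [telescope] below. *)
Lemma poisson_equation x :
  f x + K (taboo_tail f 0) x = taboo_tail f 0 x + c * one_z x.
Proof.
have h0 : taboo_tail f 0 x = off f x + taboo_tail f 1 x.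
  by rewrite /taboo_tail nneseries_recl.
rewrite taboo_tail_transition h0 /one_z /off; case: eqP => [->|_].
  by rewrite !mule1 add0e /c addeCA.
by rewrite !mule0 !adde0.
Qed.

Let one_step t :
  E t f + E t.+1 (taboo_tail f 0) = E t (taboo_tail f 0) + c * E t one_z.
Proof.
have c0 : 0 <= c by exact: adde_ge0.
rewrite markov // -expectD //; last by move=> x; exact: K_ge0.
rewrite -expectZ // -expectD //; last by move=> x; exact: mule_ge0.
by apply: eq_integral => w _; exact: poisson_equation.
Qed.

Let E_one_z_le1 t : E t one_z <= 1.
Proof.
rewrite -[leRHS](expect_cst P (Q t)); apply: expect_le => // x.
by rewrite /one_z; case: ifP.
Qed.

Let E_one_z_fin t : E t one_z \is a fin_num.
Proof.
rewrite ge0_fin_numE; last exact: expect_ge0.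
by apply: le_lt_trans (E_one_z_le1 t) _; rewrite ltry.
Qed.

Let c_fin : c \is a fin_num.
Proof. by rewrite fin_numD u_fin ge0_fin_numE // fz. Qed.

Let Eh0_fin : E 0 (taboo_tail f 0) < +oo.
Proof. by apply: le_lt_trans HQ; apply: expect_le => //; exact: taboo_tail0_le. Qed.

Let rate_fin t : c * E t one_z < +oo.
Proof.
have : c * E t one_z \is a fin_num by rewrite fin_numM.
by rewrite fin_numE ltey => /andP[].
Qed.

Let Eh_fin t : E t (taboo_tail f 0) \is a fin_num.
Proof.
rewrite ge0_fin_numE; last exact: expect_ge0.
elim: t => [//|t IH].
have : E t f + E t.+1 (taboo_tail f 0) < +oo.
  by rewrite one_step lte_add_pinfty.
by apply: le_lt_trans; apply: leeDr; exact: expect_ge0.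
Qed.

Lemma cost_fin t : E t f < +oo.
Proof.
have : E t f + E t.+1 (taboo_tail f 0) < +oo.
  rewrite one_step lte_add_pinfty //.
  by have := Eh_fin t; rewrite fin_numE ltey => /andP[].
by apply: le_lt_trans; apply: leeDl; exact: expect_ge0.
Qed.

(* The solution of the Poisson equation is an expected cost until the next
   visit to [z]; splitting it at the visits to [z] before slot [t] shows that
   its expectation at slot [t] is o(t), although it need not be bounded. *)
Let Eh_le t : E t (taboo_tail f 0) <= E 0 H + \sum_(0 <= k < t) u k.
Proof.
have : forall n, E t (taboo_tail f n)
    <= E 0 (taboo_tail f (n + t)) + \sum_(n <= k < n + t) u k.
  elim: t => [|t IH] n; first by rewrite addn0 big_geq // adde0.
  rewrite markov // (_ : E t _ = E t (taboo_tail f n.+1) + u n * E t one_z).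
    rewrite big_ltn ?addnS ?ltnS ?leq_addr // addeCA addeC.
    have := IH n.+1; rewrite addSn => /(leeD _); apply.
    by rewrite -[leRHS]mule1 lee_pmul ?expect_ge0.
  rewrite -expectZ // -expectD //; last by move=> x; exact: mule_ge0.
  by apply: eq_integral => w _; exact: taboo_tail_transition.
move=> /(_ 0%N); rewrite add0n => /le_trans; apply; apply: leeD => //.
apply: expect_le => // x; apply: le_trans (taboo_tail0_le x).
rewrite [leRHS](nneseries_split 0 t) ?add0n //.
by apply: leeDr; apply: sume_ge0.
Qed.

Let a t := fine (E t f).
Let b t := fine (E t one_z).
Let h t := fine (E t (taboo_tail f 0)).

Let telescope n : (series a n - fine c * series b n = h 0 - h n)%R.
Proof.
rewrite /series /= mulr_sumr -sumrB.
elim: n => [|n IH]; first by rewrite big_geq ?subrr.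
rewrite big_nat_recr //= IH.
have /(congr1 fine) := one_step n.
have af : E n f \is a fin_num by rewrite ge0_fin_numE ?cost_fin ?expect_ge0.
rewrite fineD // [X in _ = X -> _]fineD ?fin_numM // fineM // -/(a n) -/(b n) -/(h n) -/(h n.+1).
lra.
Qed.

Let h_ge0 n : (0 <= h n)%R.
Proof. by apply: fine_ge0; exact: expect_ge0. Qed.

Let h_le n : (h n <= fine (E 0 H) + series (fine \o u) n)%R.
Proof.
have EH : E 0 H \is a fin_num by rewrite ge0_fin_numE ?expect_ge0.
rewrite -lee_fin /h fineK // EFinD fineK // /series /= -sumEFin.
apply: le_trans (Eh_le n) _; apply: leeD => //.
by apply: lee_sum => k _; rewrite fineK.
Qed.

(** In the limit, the average cost is the average time spent at [z] times the
    expected cost of a cycle. *)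
Lemma average_cost_ratio : exists2 r : R, (fine (f z) <= r)%R &
  (arithmetic_mean (fun t => fine (E t f)) n
   - r * arithmetic_mean (fun t => fine (E t one_z)) n)%R @[n --> \oo] --> (0%R : R).
Proof.
exists (fine c).
  rewrite /c fineD ?ge0_fin_numE // ler_wpDr //.
  exact: fine_ge0.
have hu : arithmetic_mean (fine \o u) @ \oo --> (0%R : R).
  by apply: cesaro; exact: (fine_cvg u_cvg0).
have hinv : (fun n => n.+1%:R^-1%R : R) @ \oo --> (0%R : R) by exact: cvg_harmonic.
have lo : (- (fine (E 0 H) * n.+1%:R^-1 + arithmetic_mean (fine \o u) n))%R
    @[n --> \oo] --> (0%R : R).
  rewrite -[X in _ --> X]oppr0; apply: cvgN.
  rewrite -[X in _ --> X]addr0; apply: cvgD => //.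
  by rewrite -[X in _ --> X](mulr0 (fine (E 0 H))); apply: cvgMl_tmp.
have up : (h 0 * n.+1%:R^-1)%R @[n --> \oo] --> (0%R : R).
  by rewrite -[X in _ --> X](mulr0 (h 0)); apply: cvgMl_tmp.
apply: (squeeze_cvgr _ lo up); apply: nearW => n.
rewrite /arithmetic_mean /= mulrCA -mulrBr telescope.
have n0 : (0 < n.+1%:R^-1 :> R)%R by rewrite invr_gt0.
have := h_le n.+1; have := h_ge0 n.+1; have := h_ge0 0.
move: n0 (series _ _) (fine (E _ _)) (h 0) (h n.+1); move: (n.+1%:R^-1)%R.
move=> i i0 s e h0 h1; rewrite -(ler_pM2l i0) mulr0 => h0_ge0.
rewrite -(ler_pM2l i0) mulr0 => h1_ge0; rewrite -(ler_pM2l i0) => h1_le.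
by apply/andP; split; lra.
Qed.

End Cost.

(** With a Foster-Lyapunov function for the cost [f0], every cost function
    bounded by [f0] has a finite limit average. The constant cost 1 gives the
    average time spent at [z]. *)
Theorem average_cost_cvg (f0 H : S -> \bar R) :
  (forall x, 1 <= f0 x) -> (forall x, 0 <= H x) ->
  (forall x, x != z -> f0 x + K H x <= H x) -> E 0 H < +oo -> K H z < +oo ->
  forall f, (forall x, 0 <= f x) -> (forall x, f x <= f0 x) -> f z < +oo ->
  (forall t, E t f < +oo) /\
  cvgn (arithmetic_mean (fun t => fine (E t f))).
Proof.
move=> f01 H0 fH HQ Hz f fge0 ff0 fz.
have fH' g : (forall x, g x <= f0 x) -> forall x, x != z -> g x + K H x <= H x.
  by move=> gf x /fH; apply: le_trans; apply: leeD.
have [r _ rcvg] := average_cost_ratio fge0 H0 (fH' _ ff0) HQ Hz fz.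
have one0 (x : S) : 0 <= (1 : \bar R) by [].
have [r1 r1ge1 r1cvg] := average_cost_ratio one0 H0 (fH' (fun=> 1) f01) HQ Hz (ltry 1).
split; first by move=> t; exact: (cost_fin fge0 H0 (fH' _ ff0) HQ Hz fz).
pose b := arithmetic_mean
  (fun t => fine (E t (fun x => if x == z then 1%E else 0%E))).
rewrite -/b in rcvg r1cvg.
have r1gt0 : (0 < r1)%R by apply: lt_le_trans r1ge1.
have bcvg : b @ \oo --> (r1^-1)%R.
  have mean1 n : arithmetic_mean (fun t => fine (E t (fun=> 1))) n = 1%R.
    rewrite /arithmetic_mean /series /=.
    under eq_bigr do rewrite expect_cst /=.
    by rewrite big_const_nat subn0 iter_addr_0 mulVf.
  rewrite (_ : b = fun n => (r1^-1 * (1 - (1 - r1 * b n)))%R); last first.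
    by apply/funext => n; rewrite subKr mulKf // gt_eqF.
  rewrite -[X in _ --> X]mulr1; apply: cvgMl_tmp.
  rewrite -[X in _ --> X]subr0; apply: cvgB; first exact: cvg_cst.
  have -> // : (fun n => 1 - r1 * b n)%R = (fun n =>
      arithmetic_mean (fun t => fine (E t (fun=> 1%E))) n - r1 * b n)%R.
  by apply/funext => n; rewrite mean1.
apply/cvg_ex; exists (r / r1)%R.
rewrite (_ : arithmetic_mean _ = fun n =>
  ((arithmetic_mean (fun t => fine (E t f)) n - r * b n) + r * b n)%R); last first.
  by apply/funext => n; rewrite subrK.
rewrite -[X in _ --> X]add0r; apply: cvgD => //.
exact: cvgMl_tmp.
Qed.

(** The drift bound: if [V] decreases on average by at least
    [f - B] per slot, then the
    average of [f] is at most [B] in the limit. *)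
Theorem drift_average_le (V f : S -> \bar R) (B : R) :
  (forall x, 0 <= V x) -> (forall x, 0 <= f x) -> (0 <= B)%R ->
  (forall x, K V x + f x <= V x + B%:E) -> E 0 V < +oo ->
  forall n, (arithmetic_mean (fun t => fine (E t f)) n
             <= fine (E 0 V) * n.+1%:R^-1 + B)%R.
Proof.
move=> V0 f0 B0 drift EV0 n.
have step t : E t.+1 V + E t f <= E t V + B%:E.
  have KV0 := K_ge0 V0.
  rewrite markov // -(expect_cst P (Q t) B%:E) -!expectD //.
  by apply: expect_le => // x; rewrite adde_ge0.
have EV t : E t V < +oo.
  elim: t => [//|t IH].
  apply: (@le_lt_trans _ _ (E t V + B%:E)); last by rewrite lte_add_pinfty ?ltry.
  by apply: le_trans (step t); apply: leeDl; exact: expect_ge0.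
have Ef t : E t f < +oo.
  apply: (@le_lt_trans _ _ (E t V + B%:E)); last by rewrite lte_add_pinfty ?ltry ?EV.
  by apply: le_trans (step t); apply: leeDr; exact: expect_ge0.
have fV t : E t V \is a fin_num by rewrite ge0_fin_numE ?expect_ge0.
have ff t : E t f \is a fin_num by rewrite ge0_fin_numE ?expect_ge0.
have vge0 t : (0 <= fine (E t V))%R by apply: fine_ge0; exact: expect_ge0.
have sum_le m : (series (fun t => fine (E t f)) m + fine (E m V)
    <= fine (E 0 V) + m%:R * B)%R.
  rewrite /series /=; elim: m => [|m IH]; first by rewrite big_geq // add0r mul0r addr0.
  have : (fine (E m.+1 V) + fine (E m f) <= fine (E m V) + B)%R.
    by rewrite -lee_fin !EFinD !fineK.
  by rewrite big_nat_recr //= mulrSr mulrDl mul1r; lra.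
rewrite /arithmetic_mean /= mulrC ler_pdivrMr // mulrDl divfK // [(B * _)%R]mulrC.
by apply: le_trans (sum_le n.+1); rewrite lerDl.
Qed.

End ErgodicAverages.

(** * The backlog process is a Markov chain *)

Section Independence.
Context d (T : measurableType d) (R : realType) (P : probability T R).

Lemma mutually_independent_fin (A : Type) (F : A -> set (set T)) (J : finType)
    (j : J -> A) (E : J -> set T) :
  mutually_independent P F -> injective j -> (forall k, F (j k) (E k)) ->
  P (\bigcap_k E k) = (\prod_k P (E k))%E.
Proof.
move=> indep jI FE.
have := indep #|J| (fun k => j (enum_val k)) (fun k => E (enum_val k)).
rewrite (_ : \bigcap_k E (enum_val k) = \bigcap_k E k); last first.
  apply/seteqP; split=> w Ew k _; last exact: Ew.
  by have := Ew (enum_rank k) I; rewrite enum_rankK.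
move=> -> //; last by move=> k k' /jI /enum_val_inj.
by rewrite -(big_enum_val (fun k => P (E k))).
Qed.

Lemma measurable_rv_preimage d' (T' : measurableType d') (Z : {RV P >-> T'}) B :
  measurable B -> measurable (Z @^-1` B).
Proof. by move=> mB; rewrite -[_ @^-1` _]setTI; exact: measurable_funPT. Qed.

End Independence.

Section ChannelLaw.
Context d (T : measurableType d) (R : realType) (P : probability T R) (N : nat).
Context (X : onoff_processes P N) (lam : 'rV[R]_N) (p : 'I_N -> R).
Hypothesis hmodel : onoff_model X lam p.

Lemma chan_true t i : P (chan X i t @^-1` [set true]) = (p i)%:E.
Proof. by rewrite -(chan_prob hmodel i t). Qed.

Lemma chan_prob_le1 i : p i <= 1.
Proof.
by rewrite -lee_fin -(chan_true 0 i) probability_le1 //; exact: measurable_rv_preimage.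
Qed.

Lemma chan_false t i : P (chan X i t @^-1` [set false]) = (1 - p i)%:E.
Proof.
rewrite EFinB -(chan_true t) -probability_setC; last exact: measurable_rv_preimage.
by congr (P _); apply/seteqP; split => w /=; case: (chan X i t w).
Qed.

End ChannelLaw.

Section MarkovChain.
Context d (T : measurableType d) (R : realType) (P : probability T R) (N : nat).
Context (X : onoff_processes P N) (lam : 'rV[R]_N) (p : 'I_N -> R).
Hypothesis hmodel : onoff_model X lam p.
Local Notation S := {ffun 'I_N -> nat}.
Local Notation chans := {ffun 'I_N -> bool}.
Variable g : S -> chans -> R -> 'I_N.
Hypothesis mg : forall q s i, measurable [set u | g q s u = i].

(** The vectors of the arrivals of slot [t] and of the initial backlogs. *)
Definition arrivals_at t w : S := [ffun i => arr X i t w].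
Definition initial_state w : S := [ffun i => init X i w].

(** The channel states, the arrivals and the selected link of a slot. *)
Definition observation : Type := (chans * S * 'I_N)%type.
HB.instance Definition _ := Countable.on observation.

(** What happens on slot [t] when the backlogs at its beginning are [q]. *)
Definition observe t (q : S) (w : T) : observation :=
  (channel_at X t w, arrivals_at t w, g q (channel_at X t w) (rnd X t w)).

(** One slot of the queueing dynamics: a service of link [i] under the channel
    states [s], and then the arrivals. *)
Definition serve (q : S) (s : chans) (i : 'I_N) : S :=
  [ffun j => (q j - ((i == j) && s j))%N].

Definition next_state (q : S) (o : observation) : S :=
  [ffun j => (serve q o.1.1 o.2 j + o.1.2 j)%N].

(** The backlogs at the end of slot [t] when they are [q] at its beginning. *)
Definition next t q w := next_state q (observe t q w).

(** The sources of randomness of one slot: the seed of the tie-breaking rule,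
    the arrivals, and the channels; and the constraint that each of them obeys
    when the observation from [z.1] is [z.2]. *)
Definition slot_index : Type := ('I_1 + ('I_N + 'I_N))%type.
HB.instance Definition _ := Finite.on slot_index.

Definition slot_source t (j : slot_index) : source N :=
  match j with
  | inl _ => Rnd N t
  | inr (inl i) => Arr i t
  | inr (inr i) => Chan i t
  end.

Definition slot_event t (z : S * observation) (j : slot_index) : set T :=
  match j with
  | inl _ => rnd X t @^-1` [set u | g z.1 z.2.1.1 u = z.2.2]
  | inr (inl i) => arr X i t @^-1` [set z.2.1.2 i]
  | inr (inr i) => chan X i t @^-1` [set z.2.1.1 i]
  end.

Lemma slot_source_event t z j :
  source_events X (slot_source t j) (slot_event t z j).
Proof.
case: j => [j|[i|i]] /=.
- by exists [set u | g z.1 z.2.1.1 u = z.2.2].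
- by exists [set z.2.1.2 i].
- by exists [set z.2.1.1 i].
Qed.

Lemma slot_source_inj t t' j j' : slot_source t j = slot_source t' j' ->
  t = t' /\ j = j'.
Proof.
case: j => [j|[i|i]]; case: j' => [j'|[i'|i']] //= [].
- by move=> ->; rewrite (ord1 j) (ord1 j').
- by move=> -> ->.
- by move=> -> ->.
Qed.

Lemma observe_slot_event t q o :
  observe t q @^-1` [set o] = \bigcap_j slot_event t (q, o) j.
Proof.
apply/seteqP; split=> [w /= <- [j|[i|i]] _ //=|w h].
- by rewrite ffunE.
- by rewrite ffunE.
case: o h => [[s a] i] h /=.
have hs : channel_at X t w = s.
  by apply/ffunP => k; rewrite ffunE; exact: (h (inr (inr k)) I).
have ha : arrivals_at t w = a.
  by apply/ffunP => k; rewrite ffunE; exact: (h (inr (inl k)) I).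
by rewrite /observe hs ha (h (inl ord0) I : g q s (rnd X t w) = i).
Qed.

Lemma measurable_slot_event t z j : measurable (slot_event t z j).
Proof.
case: j => [j|[i|i]] /=; exact: measurable_rv_preimage.
Qed.

Lemma discrete_observe t q : discrete_rv (observe t q).
Proof.
move=> o; rewrite observe_slot_event; apply: fin_bigcap_measurable => //.
by move=> j _; exact: measurable_slot_event.
Qed.

Lemma discrete_initial : discrete_rv initial_state.
Proof.
move=> q; rewrite (_ : _ @^-1` _ = \bigcap_i (init X i @^-1` [set q i])).
  apply: fin_bigcap_measurable => // i _; exact: measurable_rv_preimage.
apply/seteqP; split=> [w /= <- i _ /=|w h]; first by rewrite ffunE.
by apply/ffunP => i; rewrite ffunE; exact: (h i I).
Qed.

Lemma slot_event_stationary t z j : P (slot_event t z j) = P (slot_event 0 z j).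
Proof.
case: j => [j|[i|i]] /=.
- exact: (rnd_identical hmodel t (mg _ _ _)).
- exact: (@arr_identical _ _ _ _ _ _ _ _ hmodel i t).
by case: (z.2.1.1 i); rewrite ?(chan_true hmodel) ?(chan_false hmodel).
Qed.

(** The probability to observe [z.2] when the backlogs are [z.1]; it does not
    depend on the slot. *)
Definition observe_prob (z : S * observation) : R :=
  fine (P (observe 0 z.1 @^-1` [set z.2])).

Lemma probability_observe t z :
  P (observe t z.1 @^-1` [set z.2]) = (observe_prob z)%:E.
Proof.
rewrite /observe_prob fineK; last first.
  by rewrite fin_num_measure //; exact: discrete_observe.
have E t' : P (observe t' z.1 @^-1` [set z.2]) = (\prod_j P (slot_event t' z j))%E.
  rewrite observe_slot_event -surjective_pairing.
  apply: (mutually_independent_fin (j := slot_source t')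
    (sources_independent hmodel)); last exact: slot_source_event.
  by move=> j j' /slot_source_inj[].
by rewrite !E; apply: eq_bigr => j _; exact: slot_event_stationary.
Qed.

(** The event that the observations of the slots from [t] on are those listed
    in [l], each with the backlogs it is made from. *)
Fixpoint observed t (l : seq (S * observation)) : set T :=
  if l is z :: l' then observe t z.1 @^-1` [set z.2] `&` observed t.+1 l'
  else setT.

Lemma observedE t l z0 : observed t l =
  \bigcap_(k in [set: 'I_(size l)])
    (observe (t + k) (nth z0 l k).1 @^-1` [set (nth z0 l k).2]).
Proof.
elim: l t => [|z l IH] t /=; first by apply/seteqP; split=> // w _ [].
rewrite IH; apply/seteqP; split=> [w [/= h0 h] [[|k] /= kl] _|w h].
- by rewrite addn0.
- by have := h (Ordinal (kl : k < size l)%N) I; rewrite addSnnS.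
split; first by have := h (Ordinal (isT : 0 < (size l).+1)%N) I; rewrite /= addn0.
move=> k _; have := h (lift ord0 k) I; by rewrite /= /bump /= add0n add1n addSnnS.
Qed.

Lemma measurable_observed t l : measurable (observed t l).
Proof.
elim: l t => [|z l IH] t //=; apply: measurableI => //; exact: discrete_observe.
Qed.

Lemma initial_observed_independent q l :
  P (initial_state @^-1` [set q] `&` observed 0 l)
  = (P (initial_state @^-1` [set q]) * (\prod_(z <- l) observe_prob z)%:E)%E.
Proof.
case: l => [|z0 l']; first by rewrite /= setIT big_nil mule1.
set l := z0 :: l'; set n := size l.
pose src (k : 'I_1 + 'I_n * slot_index) :=
  if k is inr kj then slot_source kj.1 kj.2 else Init.
pose ev (k : 'I_1 + 'I_n * slot_index) :=
  if k is inr kj then slot_event kj.1 (nth z0 l kj.1) kj.2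
  else initial_state @^-1` [set q].
rewrite (_ : _ `&` _ = \bigcap_k ev k); last first.
  rewrite (observedE 0 l z0); apply/seteqP; split=> [w [h0 h] [k|[k j]] _ //|w h].
    have := h k I; rewrite add0n => hk; rewrite /=.
    have : (observe k (nth z0 l k).1 @^-1` [set (nth z0 l k).2]) w by [].
    by rewrite observe_slot_event -surjective_pairing; apply.
  split; first exact: (h (inl ord0) I).
  move=> k _; rewrite add0n observe_slot_event -surjective_pairing => j _.
  exact: (h (inr (k, j)) I).
rewrite (mutually_independent_fin (F := source_events X) (j := src)); first last.
- case=> [k|[k j]] /=; last exact: slot_source_event.
  by exists [set q].
- case=> [k|[k j]] [k'|[k' j']] //=.
  + by rewrite (ord1 k) (ord1 k').
  + by case: j' => [?|[]].
  + by case: j => [?|[]].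
  + by move=> /slot_source_inj [/val_inj -> ->].
- exact: sources_independent hmodel.
rewrite big_sumType /= big_ord1; congr (_ * _)%E.
rewrite -(pair_bigA _ (fun (k : 'I_n) j => P (slot_event k (nth z0 l k) j))).
rewrite (big_nth z0) big_mkord -prodEFin; apply: eq_bigr => k _.
rewrite -(probability_observe k) observe_slot_event -surjective_pairing.
rewrite (mutually_independent_fin (F := source_events X) (j := slot_source k)) //.
- exact: sources_independent hmodel.
- by move=> j j' /slot_source_inj[].
- exact: slot_source_event.
Qed.

(** The backlogs, as a function of the initial backlogs and of the
    observations. *)
Fixpoint chain t w : S :=
  if t is t'.+1 then next t' (chain t' w) w else initial_state w.

Definition chain_observe t w : S * observation :=
  (chain t w, observe t (chain t w) w).

Lemma chain_observeE t z : chain_observe t @^-1` [set z] =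
  chain t @^-1` [set z.1] `&` observe t z.1 @^-1` [set z.2].
Proof.
apply/seteqP; split=> [w /= <- //|w /=].
by case: z => q o /= [<- <-].
Qed.

Lemma discrete_chain t : discrete_rv (chain t).
Proof.
elim: t => [|t IH]; first exact: discrete_initial.
have mJ : discrete_rv (chain_observe t).
  by move=> z; rewrite chain_observeE; apply: measurableI => //; exact: discrete_observe.
exact: (discrete_rv_comp (fun z => next_state z.1 z.2) mJ).
Qed.

Lemma discrete_chain_observe t : discrete_rv (chain_observe t).
Proof.
move=> z; rewrite chain_observeE; apply: measurableI; first exact: discrete_chain.
exact: discrete_observe.
Qed.

Lemma discrete_next q : discrete_rv (next 0 q).
Proof.
exact: (discrete_rv_comp (fun o => next_state q o) (@discrete_observe 0 q)).
Qed.

(** The backlogs at the beginning of slot [t] are independent of the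
    observations made from that slot on. *)
Lemma chain_observed_independent t q l :
  P (chain t @^-1` [set q] `&` observed t l)
  = (P (chain t @^-1` [set q]) * (\prod_(z <- l) observe_prob z)%:E)%E.
Proof.
elim: t q l => [|t IH] q l; first exact: initial_observed_independent.
have split_event l' : P (chain t.+1 @^-1` [set q] `&` observed t.+1 l') =
    (\esum_(z in [set: S * observation])
       ((if next_state z.1 z.2 == q then
           P (chain t @^-1` [set z.1]) * (observe_prob z)%:E else 0)
        * (\prod_(z <- l') observe_prob z)%:E))%E.
  rewrite (probability_fibers P (discrete_chain_observe t)); last first.
    by apply: measurableI; [exact: discrete_chain | exact: measurable_observed].
  apply: eq_esum => z _; case: eqP => [zq|zq].
    rewrite (_ : _ `&` _ `&` _ =
      chain t @^-1` [set z.1] `&` observed t (z :: l')).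
      by rewrite IH big_cons EFinM muleA.
    rewrite chain_observeE; apply/seteqP; split=> w /=; first by move=> [[_ ?] [? ?]].
    move=> [h1 [h2 h3]]; do 2 split => //.
    by rewrite /next h1 h2.
  rewrite mul0e (_ : _ `&` _ `&` _ = set0) ?measure0 //.
  apply/seteqP; split=> // w /= [[h _] hz]; apply: zq.
  by rewrite -hz /= -h.
have {1}-> := split_event l.
have := split_event [::]; rewrite /= setIT => ->.
rewrite muleC -esumZl; first last.
- move=> z; apply: mule_ge0; rewrite ?lee_fin ?big_nil //.
  by case: ifP => // _; apply: mule_ge0 => //; rewrite lee_fin fine_ge0.
- by apply: prodr_ge0 => z _; exact: fine_ge0.
by apply: eq_esum => z _; rewrite big_nil mule1 muleC.
Qed.

(** The Markov property. As the slots have the same law, the transitions are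
    those of slot 0. *)
Lemma chain_markov t (phi : S -> \bar R) : (forall x, 0 <= phi x)%E ->
  expect P (chain t.+1) phi = expect P (chain t) (transition P (next 0) phi).
Proof.
move=> phi0.
have op0 z : (0 <= (observe_prob z)%:E)%E by rewrite lee_fin fine_ge0.
transitivity (\esum_(z in [set: S * observation])
    (phi (next_state z.1 z.2) * (P (chain t @^-1` [set z.1]) * (observe_prob z)%:E)))%E.
  rewrite -[LHS]/(expect P (chain_observe t) (fun z => phi (next_state z.1 z.2))).
  rewrite /expect (integral_discrete P (discrete_chain_observe t)
    (phi := fun z => phi (next_state z.1 z.2))) //.
  apply: eq_esum => z _; congr (_ * _)%E.
  have := chain_observed_independent t z.1 [:: z].
  by rewrite /= setIT big_seq1 -chain_observeE.
rewrite /expect (integral_discrete P (discrete_chain t)); last by move=> x; exact: expect_ge0.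
rewrite (_ : [set: S * observation] = [set: S] `*`` (fun=> [set: observation])); last first.
  by apply/seteqP; split.
rewrite -(esum_esum (a := fun x o => phi (next_state x o) *
  (P (chain t @^-1` [set x]) * (observe_prob (x, o))%:E))%E); last first.
  by move=> x o _ _; rewrite !mule_ge0.
apply: eq_esum => x _.
rewrite /transition /expect.
rewrite (integral_discrete P (@discrete_observe 0 x)
  (phi := fun o => phi (next_state x o))) // muleC.
rewrite -(fineK (_ : P (chain t @^-1` [set x]) \is a fin_num)); last first.
  by rewrite fin_num_measure //; exact: discrete_chain.
rewrite -esumZl; first last.
- by move=> o; rewrite mule_ge0.
- exact: fine_ge0.
apply: eq_esum => o _; rewrite muleCA; congr (_ * (_ * _))%E.
by rewrite (probability_observe 0 (x, o)).
Qed.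

End MarkovChain.

(** * Moments of a single slot *)

Section IndependentProduct.
Context d (T : measurableType d) (R : realType) (P : probability T R).
Context (S S' : countType) (f : T -> S) (f' : T -> S').
Hypothesis mf : discrete_rv f.
Hypothesis mf' : discrete_rv f'.
Hypothesis indep : forall x y,
  P (f @^-1` [set x] `&` f' @^-1` [set y])
  = (P (f @^-1` [set x]) * P (f' @^-1` [set y]))%E.

(** Independent discrete random variables are uncorrelated. *)
Lemma expect_independent (phi : S -> R) (psi : S' -> R) (e : R) :
  (forall x, 0 <= phi x) -> (forall y, 0 <= psi y) ->
  expect P f' (fun y => (psi y)%:E) = e%:E ->
  expect P (fun w => (f w, f' w)) (fun z => (phi z.1 * psi z.2)%:E)
  = (expect P f (fun x => (phi x)%:E) * e%:E)%E.
Proof.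
move=> phi0 psi0 psie.
have pE x : P (f @^-1` [set x]) = (fine (P (f @^-1` [set x])))%:E.
  by rewrite fineK // fin_num_measure.
have mff' := discrete_rv_pair mf mf'.
rewrite /expect (integral_discrete P mff' (phi := fun z => (phi z.1 * psi z.2)%:E)); last first.
  by move=> z; rewrite lee_fin mulr_ge0.
rewrite (_ : [set: S * S'] = [set: S] `*`` (fun=> [set: S'])); last by apply/seteqP; split.
transitivity (\esum_(k in ([set: S] `*`` (fun=> [set: S']))%classic)
  ((phi k.1 * fine (P (f @^-1` [set k.1])))%:E *
   ((psi k.2)%:E * P (f' @^-1` [set k.2]))))%E.
  apply: eq_esum => -[x y] _ /=.
  rewrite (_ : _ @^-1` _ = f @^-1` [set x] `&` f' @^-1` [set y]); last first.
    by apply/seteqP; split=> w /= [-> ->].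
  by rewrite indep !EFinM -pE; rewrite -!muleA; congr (_ * _)%E; rewrite muleCA.
have c0 x : 0 <= phi x * fine (P (f @^-1` [set x])) by rewrite mulr_ge0 // fine_ge0.
rewrite -(esum_esum (a := fun x y => ((phi x * fine (P (f @^-1` [set x])))%:E *
   ((psi y)%:E * P (f' @^-1` [set y])))%E)); last first.
  by move=> x y _ _; rewrite !mule_ge0 // lee_fin.
have e0 : 0 <= e by rewrite -lee_fin -psie; apply: expect_ge0 => y; rewrite lee_fin.
transitivity (\esum_(x in [set: S]) (e%:E * (phi x * fine (P (f @^-1` [set x])))%:E))%E.
  apply: eq_esum => x _; rewrite esumZl //; last by move=> y; rewrite mule_ge0 // lee_fin.
  rewrite muleC -psie /expect; congr (_ * _)%E.
  by rewrite (integral_discrete P mf' (phi := fun y => (psi y)%:E)) // => y; rewrite lee_fin.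
rewrite esumZl //.
rewrite [RHS]muleC (integral_discrete P mf (phi := fun x => (phi x)%:E)); last by move=> x; rewrite lee_fin.
by congr (_ * _)%E; apply: eq_esum => x _; rewrite EFinM -pE.
Qed.

End IndependentProduct.

Section QuadraticDrift.
Context d (T : measurableType d) (R : realType) (P : probability T R).

(** Half the square of [n], plus a linear term. For a queue with arrival rate
    [l], the drift of the half square contains [1/2 - l] times the departure rate,
    and the linear term replaces it with the constant [(1/2 - l) * l]. The value
    is nonnegative because [n] is an integer and [l <= 1]. *)
Definition quad (l : R) (n : nat) : R := n%:R ^+ 2 / 2 + (2^-1 - l) * n%:R.

Lemma quad_ge0 l n : l <= 1 -> 0 <= quad l n.
Proof.
move=> l1; rewrite /quad; case: n => [|n]; first by rewrite expr0n /= mul0r mulr0 addr0.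
have n1 : 1 <= n.+1%:R :> R by rewrite ler1n.
by nra.
Qed.

(** [q] packets, [s] departures and [a] arrivals, the last two uncorrelated. *)
Lemma quad_drift (a s : T -> nat) (q : nat) (l m2 b : R) :
  discrete_rv a -> discrete_rv s ->
  0 <= l -> l <= 1 -> (forall w, s w <= 1)%N -> (forall w, s w <= q)%N ->
  (\int[P]_w (a w)%:R%:E = l%:E)%E ->
  (\int[P]_w ((a w)%:R ^+ 2)%:E = m2%:E)%E ->
  (\int[P]_w (s w)%:R%:E = b%:E)%E ->
  (\int[P]_w ((s w)%:R * (a w)%:R)%:E = (l * b)%:E)%E ->
  (\int[P]_w (quad l (q - s w + a w))%:E
   = (quad l q + (m2 / 2 + l / 2 - l ^+ 2) - q%:R * (b - l))%:E)%E.
Proof.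
move=> ma ms l0 l1 s1 sq Ea Ea2 Es Esa.
have mas := discrete_rv_pair ma ms.
have mr (h : nat * nat -> R) : measurable_fun setT (fun w => (h (a w, s w))%:E).
  exact: (measurable_discrete_comp (fun x => (h x)%:E) mas).
have ID (h k : nat * nat -> R) : (forall x, 0 <= h x) -> (forall x, 0 <= k x) ->
    (\int[P]_w (h (a w, s w) + k (a w, s w))%:E =
     \int[P]_w (h (a w, s w))%:E + \int[P]_w (k (a w, s w))%:E)%E.
  move=> h0 k0; under eq_integral do rewrite EFinD.
  by rewrite ge0_integralD // => [w _|w _]; rewrite lee_fin.
have IZ (c : R) (h : nat * nat -> R) : 0 <= c -> (forall x, 0 <= h x) ->
    (\int[P]_w (c * h (a w, s w))%:E = c%:E * \int[P]_w (h (a w, s w))%:E)%E.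
  move=> c0 h0; under eq_integral do rewrite EFinM.
  by rewrite ge0_integralZl // => w _; rewrite lee_fin.
pose A (x : nat * nat) : R := x.1%:R.
pose A2 (x : nat * nat) : R := x.1%:R ^+ 2.
pose B (x : nat * nat) : R := x.2%:R.
pose BA (x : nat * nat) : R := x.2%:R * x.1%:R.
have W0 x : 0 <= quad l x by exact: quad_ge0.
(* The integrand is signed; its negative terms are moved to the other side, so
   that only integrals of nonnegative functions occur. *)
have H : (\int[P]_w (quad l (q - s w + a w))%:E +
    \int[P]_w (q%:R * B (a w, s w) + (BA (a w, s w) + l * A (a w, s w)))%:E
    = \int[P]_w (quad l q + (2^-1 * A2 (a w, s w) + ((2^-1 + q%:R) * A (a w, s w) + l * B (a w, s w))))%:E)%E.
  rewrite -(ID (fun x => quad l (q - x.2 + x.1)) (fun x => q%:R * B x + (BA x + l * A x))) //.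
    apply: eq_integral => w _; congr _%:E; rewrite /quad /A /A2 /B /BA /=.
    rewrite natrD natrB ?sq //.
    have : (s w)%:R ^+ 2 = (s w)%:R :> R by case: (s w) (s1 w) => [|[]] // _; rewrite ?expr0n ?expr1n.
    by move: (_%:R) (_%:R) (_%:R) => x y z; nra.
  by move=> x; rewrite !addr_ge0 ?mulr_ge0.
have A0 x : 0 <= A x by [].
have A20 x : 0 <= A2 x by rewrite exprn_ge0.
have B0 x : 0 <= B x by [].
have BA0 x : 0 <= BA x by rewrite mulr_ge0.
have lA0 x : 0 <= l * A x by rewrite mulr_ge0.
have lB0 x : 0 <= l * B x by rewrite mulr_ge0.
have half0 : 0 <= 2^-1 :> R by rewrite invr_ge0.
have hq0 : 0 <= 2^-1 + q%:R :> R by rewrite addr_ge0.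
have qA0 x : 0 <= (2^-1 + q%:R) * A x by rewrite mulr_ge0.
have qB0 x : 0 <= q%:R * B x by rewrite mulr_ge0.
have hA20 x : 0 <= 2^-1 * A2 x by rewrite mulr_ge0.
move: H.
rewrite (ID (fun x => q%:R * B x) (fun x => BA x + l * A x)) //; last first.
  by move=> x; rewrite addr_ge0.
rewrite (ID BA (fun x => l * A x)) //.
rewrite (ID (fun=> quad l q) (fun x => 2^-1 * A2 x + ((2^-1 + q%:R) * A x + l * B x))) //; last first.
  by move=> x; rewrite !addr_ge0.
rewrite (ID (fun x => 2^-1 * A2 x) (fun x => (2^-1 + q%:R) * A x + l * B x)) //; last first.
  by move=> x; rewrite addr_ge0.
rewrite (ID (fun x => (2^-1 + q%:R) * A x) (fun x => l * B x)) //.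
rewrite !IZ // /A /A2 /B /BA /= Ea Ea2 Es Esa (integral_cst P measurableT).
rewrite (_ : (_ * P _)%E = (quad l q)%:E); last first.
  by rewrite -[RHS]mule1; congr (_ * _)%E; exact: probability_setT.
case: (\int[P]_w _)%E => [r| |] //; rewrite -!EFinM -!EFinD => -[E].
congr _%:E; move: E; move: (quad l q) => z E; nra.
Qed.

End QuadraticDrift.

(** * The drift of the queueing system *)

Section ConnectionProbability.
Context (R : realType) (N : nat).
Implicit Types (p : 'I_N -> R) (L : {set 'I_N}).

(** The probability that some link of [L] is connected. *)
Definition conn_prob p L : R := 1 - \prod_(i in L) (1 - p i).

Context d (T : measurableType d) (P : probability T R).
Context (X : onoff_processes P N) (lam : 'rV[R]_N) (p : 'I_N -> R).
Hypothesis hmodel : onoff_model X lam p.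

Lemma measurable_connected t L :
  measurable [set w | [exists i in L, chan X i t w]].
Proof.
rewrite (_ : [set w | _] =
    ~` \bigcap_i (if i \in L then chan X i t @^-1` [set false] else setT)).
  apply: measurableC; apply: fin_bigcap_measurable => // i _.
  by case: ifP => // _; exact: measurable_rv_preimage.
apply/seteqP; split=> w /=.
  by move=> /existsP[i /andP[iL c]] /(_ i I); rewrite iL /= c.
move=> h; apply: contrapT => /negP; rewrite negb_exists => /forallP c.
apply: h => i _; case: ifP => // iL /=.
by have := c i; rewrite iL /= => /negbTE.
Qed.

Lemma probability_connected t L :
  P [set w | [exists i in L, chan X i t w]] = (conn_prob p L)%:E.
Proof.
pose E i := if i \in L then chan X i t @^-1` [set false] else setT.
have mE i : measurable (E i).
  by rewrite /E; case: ifP => // _; exact: measurable_rv_preimage.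
rewrite (_ : [set w | _] = ~` \bigcap_i E i); last first.
  apply/seteqP; split=> w /=.
    by move=> /existsP[i /andP[iL c]] /(_ i I); rewrite /E iL /= c.
  move=> h; apply: contrapT => /negP; rewrite negb_exists => /forallP c.
  apply: h => i _; rewrite /E; case: ifP => // iL /=.
  by have := c i; rewrite iL /= => /negbTE.
rewrite probability_setC; last exact: fin_bigcap_measurable.
rewrite (mutually_independent_fin (F := source_events X) (j := fun i => Chan i t)).
- rewrite /conn_prob EFinB -prodEFin; congr (_ - _)%E.
  rewrite [RHS]big_mkcond /=; apply: eq_bigr => i _; rewrite /E; case: ifP => _.
    by rewrite (chan_false hmodel).
  exact: probability_setT.
- exact: sources_independent hmodel.
- by move=> i j [].
- move=> i /=; rewrite /E; case: ifP => _; first by exists [set false].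
  by exists setT; rewrite preimage_setT.
Qed.

Lemma arrival_rate_ge0 i : 0 <= lam ord0 i.
Proof.
rewrite -lee_fin -(arr_mean hmodel i 0); rewrite unlock.
by apply: integral_ge0 => w _; rewrite lee_fin.
Qed.

End ConnectionProbability.

(** The links with more than [m] packets. *)
Definition level N (q : {ffun 'I_N -> nat}) m : {set 'I_N} :=
  [set i | (m < q i)%N]%SET.

Lemma sum_ltn n m : (\sum_(0 <= k < n) (k < m) = minn n m)%N.
Proof.
elim: n => [|n IH]; first by rewrite big_geq ?min0n.
rewrite big_nat_recr //= IH; lia.
Qed.

Section OneSlotDrift.
Context d (T : measurableType d) (R : realType) (P : probability T R) (N : nat).
Context (X : onoff_processes P N) (lam : 'rV[R]_N) (p : 'I_N -> R).
Hypothesis hmodel : onoff_model X lam p.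
Local Notation S := {ffun 'I_N -> nat}.
Local Notation chans := {ffun 'I_N -> bool}.
Variable g : S -> chans -> R -> 'I_N.
Hypothesis mg : forall q s i, measurable [set u | g q s u = i].
Hypothesis hg : forall (q : S) (s : chans) u i,
  (q i * s i <= q (g q s u) * s (g q s u))%N.

(** The channel states and the selected link of slot 0, with backlogs [q]. *)
Definition selection (q : S) (w : T) : chans * 'I_N :=
  (channel_at X 0 w, g q (channel_at X 0 w) (rnd X 0 w)).

(** The number of packets that leave link [j]: unlike an offered service, a
    departure needs a nonempty queue. *)
Definition departure (q : S) (o : chans * 'I_N) (j : 'I_N) : nat :=
  ((o.2 == j) && o.1 j && (0 < q j)%N).

Lemma nextE q w j :
  next X g 0 q w j = (q j - departure q (selection q w) j + arr X j 0 w)%N.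
Proof.
rewrite !ffunE /= /departure /selection /= ffunE; congr (_ + _)%N.
by case: (q j) => [|n]; rewrite ?andbT ?sub0n.
Qed.

Lemma departure_le1 q o j : (departure q o j <= 1)%N.
Proof. exact: leq_b1. Qed.

Lemma departure_le q o j : (departure q o j <= q j)%N.
Proof. by rewrite /departure; case: (q j) => [|n]; rewrite ?andbF // (leq_trans (leq_b1 _)). Qed.

(* The weight of the selected link. *)
Let weight (q : S) (o : chans * 'I_N) : nat := (q o.2 * o.1 o.2)%N.

Lemma sum_weighted_departures (q : S) (o : chans * 'I_N) :
  (\sum_j q j * departure q o j)%N = weight q o.
Proof.
rewrite (bigD1 o.2) //= big1 ?addn0 => [|j jo].
  by rewrite /departure eqxx /weight /=; case: (q o.2) => [|n]; rewrite ?mul0n ?andbT.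
by rewrite /departure eq_sym (negbTE jo) muln0.
Qed.

Lemma sum_departures (q : S) (o : chans * 'I_N) : (\sum_j departure q o j)%N = (0 < weight q o)%N.
Proof.
rewrite (bigD1 o.2) //= big1 ?addn0 => [|j jo].
  by rewrite /departure eqxx /weight muln_gt0 lt0b andbC.
by rewrite /departure eq_sym (negbTE jo).
Qed.

(** The longest connected queue policy enters through this equality: the
    selected weight exceeds [m] as soon as some link with more than [m] packets
    is connected. *)
Lemma weight_gtE (q : S) w m : (m < weight q (selection q w))%N =
  [exists i in level q m, chan X i 0 w].
Proof.
apply/idP/existsP => [|[i]].
  rewrite /weight /= => h; set i := g _ _ _ in h *; exists i.
  move: h; rewrite inE !ffunE; case: (chan X i 0 w); first by rewrite muln1 => ->.
  by rewrite muln0.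
rewrite inE => /andP[mq c]; apply: (leq_trans mq).
by have := hg q (channel_at X 0 w) (rnd X 0 w) i; rewrite {1}ffunE c muln1.
Qed.

Lemma discrete_selection q : discrete_rv (selection q).
Proof.
exact: (discrete_rv_comp (fun o : observation N => (o.1.1, o.2))
  (discrete_observe X mg 0 q)).
Qed.

Lemma measurable_selection q (h : chans * 'I_N -> \bar R) :
  measurable_fun setT (fun w => h (selection q w)).
Proof. exact: (measurable_discrete_comp h (@discrete_selection q)). Qed.

Lemma sum_integral_selection (q : S) (I : Type) (r : seq I)
    (F : I -> chans * 'I_N -> R) : (forall i o, 0 <= F i o) ->
  (\sum_(i <- r) \int[P]_w (F i (selection q w))%:E
   = \int[P]_w (\sum_(i <- r) F i (selection q w))%:E)%E.
Proof.
move=> F0; rewrite -ge0_integral_sum //.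
- by apply: eq_integral => w _; rewrite sumEFin.
- by move=> i; exact: (measurable_selection q (fun o => (F i o)%:E)).
- by move=> i w _; rewrite lee_fin.
Qed.

Lemma integral_weight_gt (q : S) m :
  (\int[P]_w ((m < weight q (selection q w))%N%:R : R)%:E
   = (conn_prob p (level q m))%:E)%E.
Proof.
rewrite -(probability_connected hmodel 0) -(setIT [set w | _]).
rewrite -integral_indic //; last exact: measurable_connected.
apply: eq_integral => w _; rewrite weight_gtE indicE; congr ((nat_of_bool _)%:R%:E).
by apply/idP/idP => [/mem_set|/set_mem].
Qed.

(** The expected number of departures from link [j] with backlogs [q]. *)
Definition departure_rate q j : R :=
  fine (\int[P]_w ((departure q (selection q w) j)%:R : R)%:E)%E.

Lemma integral_departure q j :
  (\int[P]_w ((departure q (selection q w) j)%:R : R)%:E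
   = (departure_rate q j)%:E)%E.
Proof.
rewrite /departure_rate fineK // ge0_fin_numE; last first.
  by apply: integral_ge0 => w _; rewrite lee_fin.
apply: (@le_lt_trans _ _ 1%E); last by rewrite ltry.
rewrite -[leRHS](expect_cst P (@selection q)).
apply: (@expect_le _ _ _ P _ _ (fun o => ((departure q o j)%:R)%:E) (fun=> 1%E)).
- exact: discrete_selection.
- by move=> o; rewrite lee_fin.
- by move=> o; rewrite lee_fin lern1 departure_le1.
Qed.

Lemma departure_rate_sum (q : S) :
  \sum_j departure_rate q j = conn_prob p (level q 0).
Proof.
apply: EFin_inj; rewrite -integral_weight_gt -sumEFin.
under eq_bigr do rewrite -integral_departure.
rewrite (sum_integral_selection q _ (F := fun j o => (departure q o j)%:R)) //.
by apply: eq_integral => w _; rewrite -natr_sum sum_departures.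
Qed.

(** The expected largest weight, one backlog level at a time. *)
Lemma departure_rate_weighted_sum (q : S) :
  \sum_j (q j)%:R * departure_rate q j
  = \sum_(0 <= m < \sum_i q i) conn_prob p (level q m).
Proof.
apply: EFin_inj; rewrite -!sumEFin.
under [RHS]eq_bigr do rewrite -integral_weight_gt.
under [LHS]eq_bigr do rewrite EFinM -integral_departure.
have mS := measurable_selection q.
transitivity (\int[P]_w ((weight q (selection q w))%:R : R)%:E)%E.
  transitivity (\sum_j \int[P]_w ((q j)%:R * (departure q (selection q w) j)%:R : R)%:E)%E.
    apply: eq_bigr => j _; rewrite -ge0_integralZl //.
    exact: (mS (fun o => ((departure q o j)%:R)%:E)).
  rewrite (sum_integral_selection q _ (F := fun j o => (q j)%:R * (departure q o j)%:R)).
    apply: eq_integral => w _; rewrite -sum_weighted_departures natr_sum.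
    by congr _%:E; apply: eq_bigr => j _; rewrite natrM.
  by move=> j o; rewrite mulr_ge0.
rewrite (sum_integral_selection q _ (F := fun m o => (m < weight q o)%N%:R)) //.
apply: eq_integral => w _; rewrite -natr_sum; congr (_%:R%:E).
have : (weight q (selection q w) <= \sum_i q i)%N.
  set o := selection q w; rewrite (bigD1 o.2) //=.
  apply: leq_trans (leq_addr _ _); rewrite /weight.
  by case: (o.1 o.2); rewrite ?muln1 ?muln0.
by rewrite sum_ltn => /minn_idPr.
Qed.

End OneSlotDrift.

Lemma sqr_sum_le (R : realFieldType) (I : Type) (r : seq I) (x : I -> R) :
  (\sum_(i <- r) x i) ^+ 2 <= 2 ^+ size r * \sum_(i <- r) x i ^+ 2.
Proof.
elim: r => [|i r IH]; first by rewrite !big_nil expr0n mulr0.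
rewrite !big_cons /= [2 ^+ _.+1]exprS.
have c1 : 1 <= 2 ^+ size r :> R by rewrite exprn_ege1 // ler1n.
have : 0 <= (x i - \sum_(j <- r) x j) ^+ 2 by exact: sqr_ge0.
have : 0 <= (2 ^+ size r - 1) * x i ^+ 2 by rewrite mulr_ge0 ?sqr_ge0 ?subr_ge0.
move: IH c1; move: (2 ^+ _) (\sum_(j <- r) x j) (\sum_(j <- r) x j ^+ 2) (x i).
by move=> c s t y; lra.
Qed.

Section LyapunovDrift.
Context d (T : measurableType d) (R : realType) (P : probability T R) (N : nat).
Context (X : onoff_processes P N) (lam : 'rV[R]_N) (p : 'I_N -> R).
Hypothesis hmodel : onoff_model X lam p.
Local Notation S := {ffun 'I_N -> nat}.
Local Notation chans := {ffun 'I_N -> bool}.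
Variable g : S -> chans -> R -> 'I_N.
Hypothesis mg : forall q s i, measurable [set u | g q s u = i].
Hypothesis hg : forall (q : S) (s : chans) u i,
  (q i * s i <= q (g q s u) * s (g q s u))%N.
Local Notation pick := (selection X g).
Local Notation rate := (departure_rate X g).

Lemma arrivals_selection_independent q i n o :
  P (arr X i 0 @^-1` [set n] `&` pick q @^-1` [set o])
  = (P (arr X i 0 @^-1` [set n]) * P (pick q @^-1` [set o]))%E.
Proof.
case: o => s k.
pose src (j : 'I_1 + 'I_N) := if j is inr j' then Chan j' 0 else Rnd N 0.
pose ev (j : 'I_1 + 'I_N) := if j is inr j' then chan X j' 0 @^-1` [set s j']
                             else rnd X 0 @^-1` [set u | g q s u = k].
have src_inj : injective src 
  by case=> [a|a] [b|b] //=; [rewrite (ord1 a) (ord1 b) | case=> ->].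
have src_ev j : source_events X (src j) (ev j).
  by case: j => [a|a] /=; [exists [set u | g q s u = k] | exists [set s a]].
have selE : pick q @^-1` [set (s, k)] = \bigcap_j ev j.
  apply/seteqP; split=> [w /= [hs hk] [j|j] _ /=|w h].
  - by rewrite -hk -hs.
  - by rewrite -hs ffunE.
  have hs : channel_at X 0 w = s.
    by apply/ffunP => j; rewrite ffunE; exact: (h (inr j) I).
  by rewrite /selection /= hs (h (inl ord0) I : g q s (rnd X 0 w) = k).
pose src' (j : 'I_1 + ('I_1 + 'I_N)) := if j is inr j' then src j' else Arr i 0.
pose ev' (j : 'I_1 + ('I_1 + 'I_N)) := if j is inr j' then ev j' else arr X i 0 @^-1` [set n].
rewrite (_ : _ `&` _ = \bigcap_j ev' j); last first.
  rewrite selE; apply/seteqP; split=> [w [h0 h] [j|j] _ //|w h].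
    exact: (h j I).
  by split; [exact: (h (inl ord0) I) | move=> j _; exact: (h (inr j) I)].
rewrite (mutually_independent_fin (F := source_events X) (j := src')) //.
- rewrite big_sumType /= big_ord1; congr (_ * _)%E; rewrite selE.
  rewrite (mutually_independent_fin (F := source_events X) (j := src)) //.
  exact: sources_independent hmodel.
- exact: sources_independent hmodel.
- case=> [a|a] [b|b] //=.
  + by rewrite (ord1 a) (ord1 b).
  + by case: b.
  + by case: a.
  + by move=> /src_inj ->.
- by case=> [a|a] /=; [exists [set n] | exact: src_ev].
Qed.

Lemma discrete_arr i t : discrete_rv (arr X i t).
Proof. by move=> n; exact: measurable_rv_preimage. Qed.

Lemma integral_arr i : (\int[P]_w ((arr X i 0 w)%:R)%:E = (lam ord0 i)%:E)%E.
Proof. by rewrite -(arr_mean hmodel i 0) unlock. Qed.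

Lemma integral_selection_arr q i (h : chans * 'I_N -> R) e :
  (forall o, 0 <= h o) -> (\int[P]_w (h (pick q w))%:E = e%:E)%E ->
  (\int[P]_w (h (pick q w) * (arr X i 0 w)%:R)%:E = (lam ord0 i * e)%:E)%E.
Proof.
move=> h0 he.
have := expect_independent (discrete_arr i 0) (discrete_selection X mg q)
  (arrivals_selection_independent q i) (phi := fun n => n%:R) (psi := h) (e := e).
rewrite /expect /= integral_arr -EFinM => <- //.
by apply: eq_integral => w _; rewrite mulrC.
Qed.

(** The mean square of a number of packets. *)
Definition second_moment (a : T -> nat) : R :=
  fine ('E_P[fun w => ((a w)%:R ^+ 2)%R])%E.

(** The number of packets that arrive on slot 0. *)
Definition total_arrivals (w : T) : nat := (\sum_i arr X i 0 w)%N.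

Lemma discrete_total_arrivals : discrete_rv total_arrivals.
Proof.
pose f w : S := arrivals_at X 0 w.
have mf : discrete_rv f.
  move=> a; rewrite (_ : _ @^-1` _ = \bigcap_i (arr X i 0 @^-1` [set a i])).
    by apply: fin_bigcap_measurable => // i _; exact: discrete_arr.
  apply/seteqP; split=> [w /= <- i _ /=|w h]; first by rewrite ffunE.
  by apply/ffunP => i; rewrite ffunE; exact: (h i I).
move=> n; rewrite (_ : _ @^-1` _ = f @^-1` [set a | (\sum_i a i)%N = n]).
  exact: discrete_rv_preimage.
apply/seteqP; split=> w /=; rewrite /total_arrivals => h.
  by rewrite -h; apply: eq_bigr => i _; rewrite ffunE.
by rewrite -h; apply: eq_bigr => i _; rewrite ffunE.
Qed.

Lemma integral_second_moment i :
  (\int[P]_w ((arr X i 0 w)%:R ^+ 2)%:E = (second_moment (arr X i 0))%:E)%E.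
Proof.
rewrite /second_moment fineK unlock // ge0_fin_numE.
  by have := arr_square hmodel i 0; rewrite unlock.
by apply: integral_ge0 => w _; rewrite lee_fin exprn_ge0.
Qed.

Lemma integral_total_second_moment :
  (\int[P]_w ((total_arrivals w)%:R ^+ 2)%:E = (second_moment total_arrivals)%:E)%E.
Proof.
have sq0 (n : nat) : (0 <= (n%:R ^+ 2)%:E :> \bar R)%E by rewrite lee_fin exprn_ge0.
rewrite /second_moment fineK unlock // ge0_fin_numE; last by apply: integral_ge0.
have msq i : measurable_fun setT (fun w => ((arr X i 0 w)%:R ^+ 2)%:E : \bar R).
  exact: (measurable_discrete_comp (fun n => (n%:R ^+ 2)%:E) (discrete_arr i 0)).
set c : R := 2 ^+ size (index_enum 'I_N).
have c0 : (0 <= c%:E)%E by rewrite lee_fin exprn_ge0.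
apply: (@le_lt_trans _ _ (\int[P]_w (\sum_i c%:E * ((arr X i 0 w)%:R ^+ 2)%:E))%E).
  apply: ge0_le_integral => //.
  - exact: (measurable_discrete_comp (fun n => (n%:R ^+ 2)%:E) discrete_total_arrivals).
  - by apply: emeasurable_sum => i; apply: measurable_funeM.
  - move=> w _; under eq_bigr do rewrite -EFinM.
    rewrite sumEFin lee_fin -mulr_sumr natr_sum; exact: sqr_sum_le.
rewrite ge0_integral_sum //.
- apply: lte_sum_pinfty => i _; rewrite ge0_integralZl //.
  by rewrite integral_second_moment -EFinM ltry.
- by move=> i; apply: measurable_funeM.
- by move=> i w _; rewrite mule_ge0.
Qed.

Lemma integral_total_arrivals :
  (\int[P]_w ((total_arrivals w)%:R)%:E = (lam_tot lam)%:E)%E.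
Proof.
rewrite /lam_tot -sumEFin; under [RHS]eq_bigr do rewrite -integral_arr.
rewrite -ge0_integral_sum //.
- by apply: eq_integral => w _; rewrite sumEFin -natr_sum.
- by move=> i; exact: (measurable_discrete_comp (fun n => (n%:R)%:E) (discrete_arr i 0)).
Qed.

(** The Lyapunov function: one quadratic term for each queue, and one for the
    total backlog. *)
Definition lyapunov (theta : R) (q : S) : R :=
  \sum_i quad (lam ord0 i) (q i) + theta * quad (lam_tot lam) (\sum_i q i).

Hypothesis lam_le1 : lam_tot lam <= 1.

Lemma lam_tot_ge0 : 0 <= lam_tot lam.
Proof. by apply: sumr_ge0 => i _; exact: (arrival_rate_ge0 hmodel). Qed.

Lemma arrival_rate_le1 i : lam ord0 i <= 1.
Proof.
apply: le_trans lam_le1; rewrite /lam_tot (bigD1 i) //= lerDl.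
by apply: sumr_ge0 => j _; exact: (arrival_rate_ge0 hmodel).
Qed.

Lemma lyapunov_ge0 theta q : 0 <= theta -> 0 <= lyapunov theta q.
Proof.
move=> t0; rewrite addr_ge0 ?mulr_ge0 ?quad_ge0 //.
by apply: sumr_ge0 => i _; rewrite quad_ge0 // arrival_rate_le1.
Qed.

(** The drift is exact: no inequality is used before the gain is estimated. *)
Lemma lyapunov_drift theta (q : S) : 0 <= theta ->
  transition P (next X g 0) (fun x => (lyapunov theta x)%:E) q
  = (lyapunov theta q + B_ X lam theta
     - (\sum_i (q i)%:R * (rate q i - lam ord0 i)
        + theta * ((\sum_i q i)%:R * (conn_prob p (level q 0) - lam_tot lam))))%:E.
Proof.
move=> t0; set Q := (\sum_i q i)%N.
have mN := discrete_next X mg q.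
pose dep i w := departure q (pick q w) i.
pose deps w := (\sum_i dep i w)%N.
have mdep i : discrete_rv (dep i).
  exact: (discrete_rv_comp (fun o => departure q o i) (discrete_selection X mg q)).
have mdeps : discrete_rv deps.
  exact: (discrete_rv_comp (fun o => (\sum_i departure q o i)%N) (discrete_selection X mg q)).
have each i : (\int[P]_w (quad (lam ord0 i) (q i - dep i w + arr X i 0 w))%:E
   = (quad (lam ord0 i) (q i)
      + (second_moment (arr X i 0) / 2 + lam ord0 i / 2 - lam ord0 i ^+ 2)
      - (q i)%:R * (rate q i - lam ord0 i))%:E)%E.
  apply: quad_drift => //.
  - exact: discrete_arr.
  - exact: (arrival_rate_ge0 hmodel).
  - exact: arrival_rate_le1.
  - by move=> w; exact: departure_le1.
  - by move=> w; exact: departure_le.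
  - exact: integral_arr.
  - exact: integral_second_moment.
  - exact: integral_departure.
  - apply: (integral_selection_arr i (h := fun o => (departure q o i)%:R)) => //.
    exact: integral_departure.
have deps_int : (\int[P]_w ((deps w)%:R)%:E = (conn_prob p (level q 0))%:E)%E.
  rewrite -(departure_rate_sum hmodel mg hg) -sumEFin.
  under [RHS]eq_bigr do rewrite -(integral_departure _ mg).
  rewrite (sum_integral_selection X mg q _ (F := fun j o => (departure q o j)%:R)) //.
  by apply: eq_integral => w _; rewrite -natr_sum.
have total : (\int[P]_w (quad (lam_tot lam) (Q - deps w + total_arrivals w))%:E
   = (quad (lam_tot lam) Q
      + (second_moment total_arrivals / 2 + lam_tot lam / 2 - lam_tot lam ^+ 2)
      - Q%:R * (conn_prob p (level q 0) - lam_tot lam))%:E)%E.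
  apply: quad_drift => //.
  - exact: discrete_total_arrivals.
  - exact: lam_tot_ge0.
  - by move=> w; rewrite /deps /dep sum_departures leq_b1.
  - by move=> w; apply: leq_sum => i _; exact: departure_le.
  - exact: integral_total_arrivals.
  - exact: integral_total_second_moment.
  - rewrite /lam_tot mulr_suml -sumEFin.
    transitivity (\sum_i \int[P]_w ((deps w)%:R * (arr X i 0 w)%:R)%:E)%E.
      rewrite -ge0_integral_sum //.
      + apply: eq_integral => w _; rewrite sumEFin -mulr_sumr -natr_sum //.
      + move=> i; exact: (measurable_discrete_comp (fun z => (z.1%:R * z.2%:R)%:E)
          (discrete_rv_pair mdeps (discrete_arr i 0))).
    apply: eq_bigr => i _.
    apply: (integral_selection_arr i (h := fun o => (\sum_j departure q o j)%:R)) => //.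
rewrite /transition /expect.
transitivity (\int[P]_w
   ((\sum_i (quad (lam ord0 i) (q i - dep i w + arr X i 0 w))%:E) +
    theta%:E * (quad (lam_tot lam) (Q - deps w + total_arrivals w))%:E))%E.
  apply: eq_integral => w _; rewrite /lyapunov EFinD -sumEFin EFinM.
  congr (_ + _ * (quad _ _)%:E)%E.
    by apply: eq_bigr => i _; rewrite nextE.
  rewrite /Q /deps /total_arrivals -sumnB; last by move=> i _; exact: departure_le.
  by rewrite -big_split /=; apply: eq_bigr => i _; rewrite nextE.
have mW i : measurable_fun setT
    (fun w => (quad (lam ord0 i) (q i - dep i w + arr X i 0 w))%:E).
  exact: (measurable_discrete_comp (fun z => (quad _ (q i - z.1 + z.2))%:E)
    (discrete_rv_pair (mdep i) (discrete_arr i 0))).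
have mWt : measurable_fun setT
    (fun w => (quad (lam_tot lam) (Q - deps w + total_arrivals w))%:E).
  exact: (measurable_discrete_comp (fun z => (quad _ (Q - z.1 + z.2))%:E)
    (discrete_rv_pair mdeps discrete_total_arrivals)).
rewrite ge0_integralD //; first last.
all: try by move=> *; rewrite ?sume_ge0 ?mule_ge0 // => *; rewrite lee_fin quad_ge0 // arrival_rate_le1.
all: try by exact: measurable_funeM.
all: try by exact: emeasurable_sum.
rewrite ge0_integral_sum //; last by move=> *; rewrite lee_fin quad_ge0 // arrival_rate_le1.
rewrite ge0_integralZl //; last by move=> *; rewrite lee_fin quad_ge0.
under eq_bigr do rewrite each.
rewrite total sumEFin -EFinM -EFinD; congr _%:E.
rewrite /lyapunov /B_ sumrB !big_split /= sumrN.
rewrite -[fine _]/(second_moment total_arrivals) -/Q.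
rewrite -[\sum_i fine _]/(\sum_i second_moment (arr X i 0)).
rewrite -!(mulr_suml _ _ _ 2^-1) -/(lam_tot lam).
move: (\sum_i second_moment (arr X i 0)) (second_moment _) (quad _ Q).
move: (\sum_i (q i)%:R * (rate q i - lam ord0 i)) (\sum_i lam ord0 i ^+ 2).
move: (conn_prob _ _) Q%:R (\sum_i (q i)%:R ^+ 2).
move: (\sum_i (2^-1 - lam ord0 i) * (q i)%:R) (lam_tot lam).
by move=> *; field.
Qed.

End LyapunovDrift.

(** * The gain of the largest weight over the arrival rates *)

Section Gain.
Context (R : realType) (N : nat) (p : 'I_N -> R).
Hypothesis hpmin : 0 < pmin p < 1.
Hypothesis p_le1 : forall i, p i <= 1.
Local Notation r := (r_ p).
Local Notation mu := (mu_sym p).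
Local Notation S := {ffun 'I_N -> nat}.

Lemma pmin_le i : pmin p <= p i.
Proof. exact: bigmin_le_cond. Qed.

Let pmin_gt0 : 0 < pmin p. Proof. by case/andP: hpmin. Qed.
Let pmin_lt1 : pmin p < 1. Proof. by case/andP: hpmin. Qed.

Let x := 1 - pmin p.

Let x_gt0 : 0 < x. Proof. by rewrite subr_gt0. Qed.
Let x_lt1 : x < 1. Proof. by rewrite /x gtrBl. Qed.

Lemma r_0 : r 0 = 0. Proof. by rewrite /r_ expr0 subrr. Qed.

Lemma r_S k : r k.+1 = r k + pmin p * x ^+ k.
Proof. by rewrite /r_ exprS -/x; rewrite [pmin p](_ : _ = 1 - x) /x; ring. Qed.

Lemma r_le1 k : r k <= 1.
Proof. by rewrite /r_ gerBl exprn_ge0 // ltW. Qed.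

Lemma r_incr j k : (j <= k)%N -> r j <= r k.
Proof.
move=> jk; rewrite /r_ lerD2l lerN2 -/x.
by apply: ler_wiXn2l => //; exact: ltW.
Qed.

Lemma r_gt0 k : (0 < k)%N -> 0 < r k.
Proof. by case: k => // k _; rewrite /r_ subr_gt0 -/x exprn_ilt1 // ltW. Qed.

(* [r j] is a sum of [j] terms of a decreasing geometric sequence. *)
Let r_ge j k : (j <= k)%N -> j%:R * (pmin p * x ^+ k) <= r j.
Proof.
elim: j => [|j IH] jk; first by rewrite mul0r r_0.
rewrite r_S mulrSr mulrDl mul1r lerD ?IH 1?ltnW //.
rewrite ler_wpM2l //; first exact: ltW.
by apply: ler_wiXn2l; [exact: ltW|exact: ltW|exact: ltnW].
Qed.

(** [r] is concave and vanishes at 0, so that [mu] is nonincreasing. *)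
Lemma r_concave j k : (j <= k)%N -> j%:R * r k <= k%:R * r j.
Proof.
elim: k => [|k IH]; first by rewrite leqn0 => /eqP ->.
rewrite leq_eqVlt => /predU1P[->//|]; rewrite ltnS => jk.
by rewrite r_S mulrSr mulrDr mulrDl mul1r lerD ?IH ?r_ge.
Qed.

Lemma mu_sym_le j k : (0 < k)%N -> (j <= k)%N -> j%:R * mu k <= r j.
Proof.
move=> k0 jk; rewrite /mu_sym mulrA ler_pdivrMr ?ltr0n //.
by rewrite [leRHS]mulrC r_concave.
Qed.

Lemma mu_sym_decr j k : (0 < j)%N -> (j <= k)%N -> mu k <= mu j.
Proof.
move=> j0 jk; rewrite {2}/mu_sym ler_pdivlMr ?ltr0n // mulrC.
by rewrite mu_sym_le // (leq_trans j0).
Qed.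

Lemma mu_sym_gt0 k : (0 < k)%N -> 0 < mu k.
Proof. by move=> k0; rewrite divr_gt0 ?r_gt0 ?ltr0n. Qed.

Lemma conn_prob_ge_r (L : {set 'I_N}) : r #|L| <= conn_prob p L.
Proof.
rewrite /r_ /conn_prob lerD2l lerN2 -prodr_const.
by apply: ler_prod => i _; rewrite subr_ge0 p_le1 lerD2l lerN2 pmin_le.
Qed.

Lemma conn_prob_mono (L L' : {set 'I_N}) :
  L \subset L' -> conn_prob p L <= conn_prob p L'.
Proof.
move=> LL'; rewrite /conn_prob lerD2l lerN2.
rewrite [leRHS]big_mkcond [leLHS]big_mkcond /=; apply: ler_prod => i _.
have p1 := p_le1 i; have p0 : 0 <= p i := le_trans (ltW pmin_gt0) (pmin_le i).
case: (boolP (i \in L)) => [/(fintype.subsetP LL') ->|_]; first by rewrite subr_ge0 p1 lexx.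
case: (i \in L'); last by rewrite ler01 lexx.
by rewrite subr_ge0 p1 gerBl.
Qed.

(** The capacity region constraints, weighted by the levels of the backlogs:
    the expected largest weight dominates every rate vector of the region. *)
Lemma level_sum_ge (v : 'I_N -> R) (q : S) :
  (forall L : {set 'I_N}, \sum_(i in L) v i <= conn_prob p L) ->
  \sum_i (q i)%:R * v i
  <= \sum_(0 <= m < \sum_i q i) conn_prob p (level q m).
Proof.
move=> hv; set Q := (\sum_i q i)%N.
apply: (@le_trans _ _ (\sum_(0 <= m < Q) \sum_(i in level q m) v i)); last first.
  by apply: ler_sum => m _; exact: hv.
under [leRHS]eq_bigr do rewrite big_mkcond /=.
rewrite exchange_big /=; apply: ler_sum => i _.
have <- : (\sum_(0 <= m < Q) (m < q i))%N = q i.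
  rewrite sum_ltn; apply/minn_idPr; rewrite /Q (bigD1 i) //=; exact: leq_addr.
rewrite natr_sum mulr_suml; apply: ler_sum => m _.
by rewrite inE; case: (m < q i)%N; rewrite ?mul1r ?mul0r.
Qed.

Variables (lam : 'rV[R]_N) (rho : R).
Hypothesis rho_lt1 : rho < 1.
Hypothesis lam_region : forall L : {set 'I_N},
  \sum_(i in L) lam ord0 i <= rho * conn_prob p L.
Hypothesis lam_ge0 : forall i, 0 <= lam ord0 i.

(** The largest weight exceeds what the arrivals require by a multiple of the
    total backlog that depends on the number of nonempty queues. Indeed, adding
    [(1 - rho) * mu k] to the rates of the [k] nonempty queues leads to a rate
    vector that still satisfies the constraints. *)
Lemma level_sum_gain (q : S) : (0 < #|level q 0|)%N ->
  (1 - rho) * mu #|level q 0| * (\sum_i q i)%:R + \sum_i (q i)%:R * lam ord0 i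
  <= \sum_(0 <= m < \sum_i q i) conn_prob p (level q m).
Proof.
set L0 := level q 0; set k := #|L0| => k0.
have r0 : 0 < 1 - rho by rewrite subr_gt0.
pose v i := (1 - rho) * (mu k * (i \in L0)%:R) + lam ord0 i.
have : \sum_i (q i)%:R * v i
    <= \sum_(0 <= m < \sum_i q i) conn_prob p (level q m).
  apply: level_sum_ge => L; rewrite /v big_split /= -mulr_sumr -mulr_sumr.
  have -> : \sum_(i in L) (i \in L0)%:R = #|L :&: L0|%:R :> R.
    rewrite -natr_sum -sum1_card; congr _%:R.
    rewrite [RHS](eq_bigl (fun i => (i \in L) && (i \in L0))); last by move=> i; rewrite inE.
    by rewrite big_mkcondr /=; apply: eq_bigr => i _; case: (i \in L0).
  have h1 : #|L :&: L0|%:R * mu k <= conn_prob p L.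
    apply: le_trans (conn_prob_mono (subsetIl L L0)).
    apply: le_trans (conn_prob_ge_r _).
    by apply: mu_sym_le => //; exact: subset_leq_card (subsetIr _ _).
  have h2 := lam_region L.
  have h3 : (1 - rho) * (#|L :&: L0|%:R * mu k) <= (1 - rho) * conn_prob p L.
    by rewrite ler_pM2l.
  by rewrite [mu k * _]mulrC; lra.
apply: le_trans; rewrite le_eqVlt; apply/orP; left; apply/eqP.
rewrite /v; under [RHS]eq_bigr do rewrite mulrDr; rewrite big_split /=; congr (_ + _).
rewrite natr_sum mulr_sumr; apply: eq_bigr => i _.
by rewrite inE; case: (q i) => [|n]; rewrite ?mul0r ?mulr0 // mulr1 mulrC.
Qed.

Hypothesis hN : (0 < N)%N.

Lemma level_sum_gain0 (q : S) :
  (1 - rho) * mu N * (\sum_i q i)%:R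
  <= \sum_(0 <= m < \sum_i q i) conn_prob p (level q m)
     - \sum_i (q i)%:R * lam ord0 i.
Proof.
have [k0|k0] := posnP #|level q 0|.
  have q0 i : q i = 0%N.
    by move/eqP: k0; rewrite cards_eq0 => /eqP/setP/(_ i); rewrite !inE lt0n => /negbFE/eqP.
  rewrite big1 // mulr0 big_geq // big1 ?subrr // => i _.
  by rewrite q0 mul0r.
rewrite lerBrDr; apply: le_trans (level_sum_gain k0).
rewrite lerD2r ler_wpM2r // ler_wpM2l //; first by rewrite subr_ge0 ltW.
by apply: mu_sym_decr => //; rewrite -[leqRHS]card_ord max_card.
Qed.

(** The drift rate, for the weight [theta_] of the total backlog: this weight
    makes the bounds for at most [K] and for more than [K] nonempty queues
    equal. *)
Definition gain K : R := (1 - rho) / r K.+1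
  * (mu K * (r K.+1 - lam_tot lam) + mu N * lam_tot lam).

Lemma level_sum_theta_gain K (q : S) :
  (0 < K)%N -> (K < N)%N -> lam_tot lam < r K.+1 ->
  gain K * (\sum_i q i)%:R
  <= \sum_(0 <= m < \sum_i q i) conn_prob p (level q m)
     - \sum_i (q i)%:R * lam ord0 i
     + theta_ p rho K
       * ((\sum_i q i)%:R * (conn_prob p (level q 0) - lam_tot lam)).
Proof.
move=> K0 KN hr.
have [k0|k0] := posnP #|level q 0|.
  have q0 i : q i = 0%N.
    by move/eqP: k0; rewrite cards_eq0 => /eqP/setP/(_ i); rewrite !inE lt0n => /negbFE/eqP.
  rewrite (_ : \sum_i q i = 0)%N; last by rewrite big1.
  rewrite mulr0 mul0r mulr0 addr0 big_geq // big1 ?subrr // => i _.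
  by rewrite q0 mul0r.
have gk := level_sum_gain k0.
set Q : R := (\sum_i q i)%:R in gk *.
have Q0 : 0 <= Q by [].
set k := #|level q 0| in k0 gk.
have rK : 0 < r K.+1 by exact: r_gt0.
have l0 : 0 <= lam_tot lam by exact: sumr_ge0.
have r0 : 0 < 1 - rho by rewrite subr_gt0.
have muKN : mu N <= mu K by apply: mu_sym_decr => //; exact: ltnW.
have th0 : 0 <= theta_ p rho K.
  rewrite /theta_ KN; apply: divr_ge0; last exact: ltW.
  by apply: mulr_ge0; rewrite subr_ge0 // ltW.
have thE : theta_ p rho K * r K.+1 = (1 - rho) * (mu K - mu N).
  by rewrite /theta_ KN divfK // gt_eqF.
have gE : gain K = (1 - rho) * mu K - theta_ p rho K * lam_tot lam.
  by rewrite /gain /theta_ KN; field; rewrite gt_eqF.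
have conn_r : r k <= conn_prob p (level q 0) by exact: conn_prob_ge_r.
suff : gain K <= (1 - rho) * mu k + theta_ p rho K * (r k - lam_tot lam).
  move=> /(ler_wpM2r Q0).
  have := ler_wpM2r Q0 (ler_wpM2l th0 conn_r).
  move: gk; move: (\sum_(0 <= m < _) _) => G; move: (\sum_i _ * _) => W.
  lra.
have [kK|Kk] := leqP k K.
  have := mu_sym_decr k0 kK; rewrite -(ler_pM2l r0).
  have := mulr_ge0 th0 (ltW (r_gt0 k0)); rewrite gE; lra.
have kN : (k <= N)%N by rewrite -[leqRHS]card_ord max_card.
have := mu_sym_decr k0 kN; rewrite -(ler_pM2l r0).
have := ler_wpM2l th0 (r_incr Kk); rewrite thE gE; lra.
Qed.

Lemma gain_gt0 K : (0 < K)%N -> lam_tot lam < r K.+1 -> 0 < gain K.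
Proof.
move=> K0 hr; rewrite /gain mulr_gt0 //.
  by rewrite divr_gt0 ?r_gt0 ?subr_gt0.
have l0 : 0 <= lam_tot lam by exact: sumr_ge0.
apply: ltr_wpDr; first by apply: mulr_ge0 => //; rewrite ltW // mu_sym_gt0.
by rewrite mulr_gt0 ?subr_gt0 ?mu_sym_gt0.
Qed.

Lemma C_gain K (B : R) : (0 < K)%N -> (K < N)%N -> lam_tot lam < r K.+1 ->
  K%:R * B * C_ p lam rho K / (1 - rho) ^+ 2 = B / gain K.
Proof.
move=> K0 KN hr; have g0 := gain_gt0 K0 hr.
have rK : 0 < r K.+1 by exact: r_gt0.
have r0 : 0 < 1 - rho by rewrite subr_gt0.
have K0' : 0 < K%:R :> R by rewrite ltr0n.
have N0' : 0 < N%:R :> R by rewrite ltr0n.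
have -> : C_ p lam rho K = (1 - rho) ^+ 2 / (K%:R * gain K).
  rewrite /C_ KN.
  have -> : r N * K%:R * lam_tot lam / (N%:R * (1 - rho))
      + r K * (r K.+1 - lam_tot lam) / (1 - rho)
      = K%:R * gain K * r K.+1 / (1 - rho) ^+ 2.
    by rewrite /gain /mu_sym; field; rewrite !gt_eqF.
  by field; rewrite !gt_eqF.
by field; rewrite !gt_eqF.
Qed.

End Gain.

(** * The constraints of the capacity region *)

Section Necessity.
Context d (T : measurableType d) (R : realType) (P : probability T R) (N : nat).
Context (X : onoff_processes P N) (lam : 'rV[R]_N) (p : 'I_N -> R).
Context (sel : nat -> T -> option 'I_N).
Hypothesis hmodel : onoff_model X lam p.
Hypothesis msel : forall t B, measurable (sel t @^-1` B).

Lemma discrete_backlog i t : discrete_rv (backlog X sel i t).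
Proof.
elim: t => [|t IH]; first by move=> n; exact: measurable_rv_preimage.
have mchan : discrete_rv (chan X i t).
  by move=> b; exact: measurable_rv_preimage.
have msel' : discrete_rv (sel t) by move=> o; exact: msel.
exact: (discrete_rv_comp
  (fun z => (z.1.1 - ((z.2 == Some i) && z.1.2.1) + z.1.2.2)%N)
  (discrete_rv_pair (discrete_rv_pair IH
    (discrete_rv_pair mchan (discrete_arr X i t))) msel')).
Qed.

Local Notation Eb i t := (\int[P]_w ((backlog X sel i t w)%:R)%:E)%E.

(** At most one packet leaves the links of [L] on a slot, and only if one of
    these links is connected. *)
Lemma backlog_step_ge (L : {set 'I_N}) t w :
  (\sum_(i in L) arr X i t w + \sum_(i in L) backlog X sel i t w
   <= \sum_(i in L) backlog X sel i t.+1 w + [exists i in L, chan X i t w])%N.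
Proof.
pose dep i := ((sel t w == Some i) && chan X i t w : nat).
have h1 : (\sum_(i in L) arr X i t w + \sum_(i in L) backlog X sel i t w
    <= \sum_(i in L) backlog X sel i t.+1 w + \sum_(i in L) dep i)%N.
  rewrite -!big_split /=; apply: leq_sum => i _; rewrite /dep.
  by move: (_ && _) => b; case: b => /=; lia.
apply: (leq_trans h1); rewrite leq_add2l {h1}.
case: (sel t w) @dep => [j|] dep; last first.
  by rewrite big1 // => i _; rewrite /dep.
have [jL|jL] := boolP (j \in L); last first.
  rewrite big1 // => i iL; rewrite /dep /=.
  by case: eqP => // -[ji]; rewrite ji iL in jL.
rewrite (bigD1 j) //= big1 => [|i /andP[_ ij]]; last first.
  by rewrite /dep; case: eqP => // -[ji]; rewrite ji eqxx in ij.
rewrite addn0 /dep eqxx /=; case: (boolP (chan X j t w)) => // cj.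
rewrite (_ : [exists i in L, _] = true) //; apply/existsP; exists j.
by rewrite jL.
Qed.

Lemma integral_arr_at i t :
  (\int[P]_w ((arr X i t w)%:R)%:E = (lam ord0 i)%:E)%E.
Proof. by rewrite -(arr_mean hmodel i t) unlock. Qed.

Lemma sum_integral_nat (L : {set 'I_N}) (F : 'I_N -> T -> nat) :
  (forall i, discrete_rv (F i)) ->
  (\sum_(i in L) \int[P]_w ((F i w)%:R : R)%:E
   = \int[P]_w ((\sum_(i in L) F i w)%N%:R : R)%:E)%E.
Proof.
move=> mF; rewrite -big_enum /= -ge0_integral_sum //.
- by apply: eq_integral => w _; rewrite sumEFin -natr_sum big_enum.
- by move=> i; exact: (measurable_discrete_comp (fun n => (n%:R)%:E) (mF i)).
Qed.

Lemma discrete_sum (L : {set 'I_N}) (F : 'I_N -> T -> nat) :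
  (forall i, discrete_rv (F i)) -> discrete_rv (fun w => \sum_(i in L) F i w)%N.
Proof.
move=> mF; rewrite (_ : (fun w => _) = fun w => (\sum_(i <- enum L) F i w)%N); last first.
  by apply/funext => w; rewrite big_enum.
elim: (enum L) => [|i r IH].
  rewrite (_ : (fun w => _) = cst 0%N); last by apply/funext => w; rewrite big_nil.
  by move=> n; rewrite preimage_cst; case: ifP.
rewrite (_ : (fun w => _) = fun w => (F i w + \sum_(i <- r) F i w)%N); last first.
  by apply/funext => w; rewrite big_cons.
exact: (discrete_rv_comp (fun z => z.1 + z.2)%N (discrete_rv_pair (mF i) IH)).
Qed.

Lemma expected_backlog_step_ge (L : {set 'I_N}) t :
  ((\sum_(i in L) lam ord0 i)%:E + \sum_(i in L) Eb i t
   <= \sum_(i in L) Eb i t.+1 + (conn_prob p L)%:E)%E.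
Proof.
have mb t' := discrete_sum L (fun i => @discrete_backlog i t').
have ma := discrete_sum L (fun i => discrete_arr X i t).
have mc : discrete_rv (fun w => [exists i in L, chan X i t w]).
  have mt : measurable [set w | [exists i in L, chan X i t w]].
    exact: measurable_connected.
  case; first exact: mt.
  rewrite (_ : _ @^-1` _ = ~` [set w | [exists i in L, chan X i t w]]).
    exact: measurableC.
  by apply/seteqP; split=> w /= => [->//|]; move/negP/negbTE.
have mr (f : T -> nat) : discrete_rv f ->
    measurable_fun setT (fun w => ((f w)%:R)%:E : \bar R).
  by move=> mf; exact: (measurable_discrete_comp (fun n => (n%:R)%:E) mf).
have mc' : discrete_rv (fun w => [exists i in L, chan X i t w] : nat).
  exact: (discrete_rv_comp nat_of_bool mc).
rewrite (_ : (conn_prob p L)%:E =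
    \int[P]_w (([exists i in L, chan X i t w] : nat)%:R : R)%:E)%E; last first.
  rewrite -(probability_connected hmodel t L) -(setIT [set w | _]).
  rewrite -integral_indic //; last exact: measurable_connected.
  apply: eq_integral => w _; rewrite indicE; congr ((nat_of_bool _)%:R%:E).
  by apply/idP/idP => [/set_mem|/mem_set].
rewrite -sumEFin; under eq_bigr do rewrite -(integral_arr_at _ t).
rewrite !sum_integral_nat; first last.
all: try by move=> i; first [exact: discrete_backlog | exact: discrete_arr].
rewrite -!ge0_integralD //; try exact: mr.
apply: ge0_le_integral => //.
- by move=> w _; rewrite -EFinD lee_fin.
- exact: (emeasurable_funD (mr _ ma) (mr _ (mb t))).
- exact: (emeasurable_funD (mr _ (mb t.+1)) (mr _ mc')).
- by move=> w _; rewrite -!EFinD lee_fin -!natrD ler_nat backlog_step_ge.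
Qed.

Lemma expected_backlog_ge (L : {set 'I_N}) t :
  ((t%:R * (\sum_(i in L) lam ord0 i - conn_prob p L))%:E
   <= \sum_(i in L) Eb i t)%E.
Proof.
elim: t => [|t IH].
  by rewrite mul0r; apply: sume_ge0 => i _; apply: integral_ge0 => w _; rewrite lee_fin.
have := expected_backlog_step_ge L t; rewrite -leeBlDr //; apply: le_trans.
rewrite leeBrDr // mulrSr mulrDl mul1r -EFinD.
rewrite [in leRHS]addeC.
have -> : t%:R * (\sum_(i in L) lam ord0 i - conn_prob p L)
    + (\sum_(i in L) lam ord0 i - conn_prob p L) + conn_prob p L
    = t%:R * (\sum_(i in L) lam ord0 i - conn_prob p L) + \sum_(i in L) lam ord0 i.
  by rewrite -addrA subrK.
by rewrite EFinD leeD2r.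
Qed.

Lemma avg_backlogE i t : avg_backlog X sel i t =
  ((t%:R^-1)%:E * \sum_(0 <= tau < t) Eb i tau)%E.
Proof. by rewrite /avg_backlog; congr (_ * _)%E; apply: eq_bigr => tau _; rewrite unlock. Qed.

(** A finite upper limit bounds the averages from some slot on. *)
Lemma strongly_stable_bounded i : strongly_stable X sel i ->
  exists M : R, \forall n \near \oo, (avg_backlog X sel i n <= M%:E)%E.
Proof.
rewrite /strongly_stable /limn_esup /limf_esup => /ereal_inf_lt [_ [V hV <-] hlt].
have : exists M : R, (ereal_sup (avg_backlog X sel i @` V) <= M%:E)%E.
  move: hlt; case: (ereal_sup _) => [r _| //|_]; first by exists r.
  by exists 0; rewrite leNye.
move=> [M hM]; exists M; apply: filterS hV => n Vn.
by apply: le_trans hM; apply: ereal_sup_ubound; exists n.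
Qed.

(** If the arrival rate exceeded the service rate of [L] by [dl], the expected
    backlog of [L] would be at least [t * dl] and its average would diverge. *)
Lemma stable_rate_le (L : {set 'I_N}) :
  (forall i, strongly_stable X sel i) ->
  \sum_(i in L) lam ord0 i <= conn_prob p L.
Proof.
move=> hstab; rewrite leNgt; apply/negP; rewrite -subr_gt0 => d0.
set dl := _ - _ in d0.
have /choice [M hM] i := strongly_stable_bounded (hstab i).
have : \forall n \near \oo, forall i, (avg_backlog X sel i n <= (M i)%:E)%E.
  exact: filter_forall.
move=> [n0 _ hn0].
pose B := \sum_(i in L) M i.
have [m hm] : exists m : nat, 2 * B / dl + 1 < m%:R.
  by exists (Num.truncn (2 * B / dl + 1)).+1; rewrite truncnS_gt.
pose n := (maxn n0 m).+1.
have n0n : (n0 <= n)%N by rewrite /n; lia.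
have mn : (m <= n.-1)%N by rewrite /n; lia.
have hn := hn0 n n0n.
have ub : (\sum_(i in L) avg_backlog X sel i n <= B%:E)%E.
  by rewrite /B -sumEFin; apply: lee_sum => i _; exact: hn.
have lb : ((n%:R^-1 * \sum_(0 <= tau < n) (tau%:R * dl))%:E
    <= \sum_(i in L) avg_backlog X sel i n)%E.
  under [leRHS]eq_bigr do rewrite avg_backlogE.
  rewrite -ge0_sume_distrr; last first.
    by move=> i _; apply: sume_ge0 => t _; apply: integral_ge0 => w _; rewrite lee_fin.
  rewrite exchange_big /= EFinM lee_wpmul2l ?lee_fin ?invr_ge0 //.
  by rewrite -sumEFin; apply: lee_sum => t _; exact: expected_backlog_ge.
have := le_trans lb ub; rewrite lee_fin -mulr_suml => {lb ub}.
have -> k : \sum_(0 <= i < k.+1) i%:R = k%:R * k.+1%:R / 2 :> R.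
  elim: k => [|k IH]; first by rewrite big_nat1 !mul0r.
  by rewrite big_nat_recr //= IH -[k.+2%:R]natr1 -[k.+1%:R]natr1; field.
have -> : n%:R^-1 * ((maxn n0 m)%:R * n%:R / 2 * dl) = n.-1%:R * dl / 2.
  by rewrite /=; field; rewrite pnatr_eq0.
apply/negP; rewrite -ltNge.
have : m%:R <= n.-1%:R :> R by rewrite ler_nat.
have B' : 2 * B / dl * dl = 2 * B by rewrite divfK // gt_eqF.
move: hm B'; move: (2 * B / dl) => z hm B' h.
have : (z + 1) * dl < n.-1%:R * dl by rewrite ltr_pM2r //; lra.
by clearbody B dl; lra.
Qed.

End Necessity.

(** The constraints are closed, so they extend from the stabilizable rates to
    the capacity region. *)
Lemma capacity_region_le (R : realType) (N : nat) (p : 'I_N -> R) (v : 'rV[R]_N)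
    (L : {set 'I_N}) :
  capacity_region p v -> \sum_(i in L) v ord0 i <= conn_prob p L.
Proof.
move=> hv; apply/ler_addgt0Pr => e e0.
have e0' : 0 < e / (N%:R + 1) by rewrite divr_gt0 // ltr_wpDl.
have [y [hy /= vy]] := hv _ (nbhsx_ballx v _ e0').
have yL : \sum_(i in L) y ord0 i <= conn_prob p L.
  case: hy => d [T [P [X [sel [hm [hsel _] hst]]]]].
  exact: (stable_rate_le hm hsel).
have : \sum_(i in L) v ord0 i <= \sum_(i in L) (y ord0 i + e / (N%:R + 1)).
  apply: ler_sum => i _; have [_ /(_ ord0 i)] : 0 < e / (N%:R + 1) /\
    forall i j, ball (v i j) (e / (N%:R + 1)) (y i j) := vy.
  by rewrite /ball /= ltr_distl => /andP[_ ?]; lra.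
move=> /le_trans; apply; rewrite big_split /=; apply: lerD => //.
rewrite sumr_const -[leLHS]mulr_natr mulrAC ler_pdivrMr ?ltr_wpDl //.
rewrite ler_pM2l // ler_wpDr // ler_nat -[leqRHS]card_ord.
exact: max_card.
Qed.

(** * Stability and time averages under the longest connected queue policy *)

Section LongestConnectedQueue.
Context d (T : measurableType d) (R : realType) (P : probability T R) (N : nat).
Context (X : onoff_processes P N) (lam : 'rV[R]_N) (p : 'I_N -> R).
Hypothesis hmodel : onoff_model X lam p.
Local Notation S := {ffun 'I_N -> nat}.
Local Notation chans := {ffun 'I_N -> bool}.
Variable g : S -> chans -> R -> 'I_N.
Hypothesis mg : forall q s i, measurable [set u | g q s u = i].
Hypothesis hg : forall (q : S) (s : chans) u i,
  (q i * s i <= q (g q s u) * s (g q s u))%N.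
Hypothesis p_gt0 : forall i, 0 < p i.
Hypothesis lam_lt1 : lam_tot lam < 1.
Local Notation K := (transition P (next X g 0)).
Local Notation E t phi := (expect P (chain X g t) phi).

(** The total backlog, and the state with no backlog. *)
Definition total (q : S) : nat := (\sum_i q i)%N.

Definition empty : S := [ffun=> 0%N].

Lemma total_eq0 q : (total q == 0%N) = (q == empty).
Proof.
rewrite sum_nat_eq0; apply/forallP/eqP => [h|-> i]; last by rewrite ffunE.
by apply/ffunP => i; rewrite ffunE; exact/eqP/h.
Qed.

(** The event that nothing arrives and that all the links are connected. *)
Definition idle : set T :=
  \bigcap_i (arr X i 0 @^-1` [set 0%N] `&` chan X i 0 @^-1` [set true]).

Lemma measurable_idle : measurable idle.
Proof.
apply: fin_bigcap_measurable => // i _.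
by apply: measurableI; exact: measurable_rv_preimage.
Qed.

(** This is Markov's inequality, as the rates are smaller than 1. *)
Lemma no_arrival_gt0 i : (0 < P (arr X i 0 @^-1` [set 0%N]))%E.
Proof.
set A := arr X i 0 @^-1` [set 0%N].
have mA : measurable A by exact: measurable_rv_preimage.
have ma : measurable_fun setT (fun w => ((arr X i 0 w)%:R)%:E : \bar R).
  exact: (measurable_discrete_comp (fun n => (n%:R)%:E) (discrete_arr X i 0)).
have mI : measurable_fun setT (fun w => (\1_A w)%:E : \bar R).
  by apply/measurable_EFinP; exact: measurable_indic.
have : (1 <= P A + (lam ord0 i)%:E)%E.
  rewrite -(integral_arr hmodel) -(setIT A) -integral_indic // -ge0_integralD //.
  rewrite -[leLHS](expect_cst P (arr X i 0)); apply: ge0_le_integral => //.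
  - exact: emeasurable_funD.
  - move=> w _; rewrite -EFinD lee_fin indicE.
    have [wA|wA] := boolP (w \in A); first by rewrite lerDl.
    rewrite add0r ler1n lt0n; apply: contra wA => /eqP h.
    by rewrite inE.
have li : lam ord0 i < 1.
  apply: le_lt_trans lam_lt1; rewrite /lam_tot (bigD1 i) //= lerDl.
  by apply: sumr_ge0 => j _; exact: (arrival_rate_ge0 hmodel).
have : P A \is a fin_num by rewrite fin_num_measure.
by case: (P A) => // r _; rewrite -EFinD lee_fin lte_fin; lra.
Qed.

Lemma probability_idle_gt0 : (0 < P idle)%E.
Proof.
pose src (j : 'I_N + 'I_N) :=
  match j with inl i => Arr i 0 | inr i => Chan i 0 end.
pose ev (j : 'I_N + 'I_N) := match j with
  | inl i => arr X i 0 @^-1` [set 0%N] | inr i => chan X i 0 @^-1` [set true] end.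
rewrite (_ : idle = \bigcap_j ev j); last first.
  apply/seteqP; split=> [w h [i|i] _|w h i _].
  - by case: (h i I).
  - by case: (h i I).
  - by split; [exact: (h (inl i) I) | exact: (h (inr i) I)].
rewrite (mutually_independent_fin (F := source_events X) (j := src)).
- rewrite big_sumType /=; apply: mule_gt0.
    by elim/big_ind: _ => // [x y|i _]; [exact: mule_gt0 | exact: no_arrival_gt0].
  elim/big_ind: _ => // [x y|i _]; first exact: mule_gt0.
  by rewrite (chan_true hmodel) lte_fin.
- exact: sources_independent hmodel.
- by case=> [i|i] [j|j] //= [->].
- by case=> [i|i] /=; [exists [set 0%N] | exists [set true]].
Qed.

Definition idle_prob : R := fine (P idle).

Lemma idle_probE : P idle = idle_prob%:E.
Proof. by rewrite fineK // fin_num_measure //; exact: measurable_idle. Qed.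

Lemma idle_prob_gt0 : 0 < idle_prob.
Proof. by rewrite -lte_fin -idle_probE probability_idle_gt0. Qed.

Lemma idle_prob_le1 : idle_prob <= 1.
Proof. by rewrite -lee_fin -idle_probE probability_le1 //; exact: measurable_idle. Qed.

(** On an idle slot, a nonempty system loses one packet. *)
Lemma total_next_idle q w : idle w -> (0 < total q)%N ->
  total (next X g 0 q w) = (total q).-1.
Proof.
move=> hw q0; rewrite /total.
have /existsP[i qi] : [exists i, (0 < q i)%N].
  apply: contraTT q0; rewrite negb_exists => /forallP h.
  rewrite -leqNgt leqn0 /total sum_nat_eq0; apply/forallP => i.
  by have := h i; rewrite -leqNgt leqn0.
rewrite (eq_bigr (fun j => q j - departure q (selection X g q w) j)%N); last first.
  by move=> j _; rewrite nextE; have [-> _] := hw j I; rewrite addn0.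
rewrite sumnB; last by move=> j _; exact: departure_le.
rewrite sum_departures (weight_gtE X hg) (_ : [exists j in _, _] = true) ?subn1 //.
apply/existsP; exists i; rewrite inE qi.
by have [_ ->] := hw i I.
Qed.

Let gamma := idle_prob / 2.

Let gamma_gt0 : 0 < gamma. Proof. by rewrite divr_gt0 // idle_prob_gt0. Qed.
Let gamma_le1 : gamma <= 1.
Proof. by rewrite ler_pdivrMr // mul1r (le_trans idle_prob_le1) // ler1n. Qed.

(** A bounded function with a negative drift at every nonempty state: the total
    backlog decreases with probability at least [idle_prob], which is twice
    [gamma], and the function never exceeds 1. *)
Definition occupied (q : S) : R := 1 - gamma ^+ total q.

Lemma occupied_ge0 q : 0 <= occupied q.
Proof. by rewrite subr_ge0 exprn_ile1 // ltW. Qed.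

Lemma occupied_le1 q : occupied q <= 1.
Proof. by rewrite gerBl exprn_ge0 // ltW. Qed.

Lemma occupied_drift q : q != empty ->
  (K (fun x => (occupied x)%:E) q <= (occupied q - gamma ^+ total q)%:E)%E.
Proof.
rewrite -total_eq0 -lt0n => q0.
have mI : measurable_fun setT (fun w => (\1_idle w)%:E : \bar R).
  by apply/measurable_EFinP; apply: measurable_indic; exact: measurable_idle.
have mN : measurable_fun setT (fun w => (occupied (next X g 0 q w))%:E).
  exact: (measurable_discrete_comp (fun x => (occupied x)%:E) (discrete_next X mg q)).
set c := gamma ^+ (total q).-1.
have c0 : 0 <= c by rewrite exprn_ge0 // ltW.
have : (K (fun x => (occupied x)%:E) q + (c * idle_prob)%:E <= 1)%E.
  rewrite EFinM -idle_probE -(setIT idle) -integral_indic //; last exact: measurable_idle.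
  rewrite -ge0_integralZl //.
  rewrite /transition /expect -ge0_integralD //; first last.
  all: try by move=> w _; rewrite ?mule_ge0 ?lee_fin ?occupied_ge0.
  all: try by exact: measurable_funeM.
  rewrite -[leRHS](expect_cst P (next X g 0 q)); apply: ge0_le_integral => //.
  - by move=> w _; rewrite adde_ge0 ?mule_ge0 ?lee_fin ?occupied_ge0.
  - by apply: emeasurable_funD => //; exact: measurable_funeM.
  move=> w _; rewrite -EFinM -EFinD lee_fin indicE.
  have [/set_mem wI|wI] := boolP (w \in idle); last first.
    by rewrite mulr0 addr0 occupied_le1.
  by rewrite mulr1 /occupied total_next_idle // subrK.
have KF : K (fun x => (occupied x)%:E) q \is a fin_num.
  rewrite ge0_fin_numE; last by apply: expect_ge0 => x; rewrite lee_fin occupied_ge0.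
  apply: (@le_lt_trans _ _ 1%E); last by rewrite ltry.
  rewrite -[leRHS](expect_cst P (next X g 0 q)); apply: expect_le.
  - exact: discrete_next.
  - by move=> x; rewrite lee_fin occupied_ge0.
  - by move=> x; rewrite lee_fin occupied_le1.
rewrite -(fineK KF) -EFinD !lee_fin /occupied.
have -> : gamma ^+ total q = c * gamma by rewrite -exprSr prednK.
have -> : idle_prob = gamma + gamma by rewrite /gamma; field.
lra.
Qed.

Lemma initial_second_moment :
  (E 0 (fun q => (\sum_i (q i)%:R ^+ 2)%:E) < +oo)%E.
Proof.
rewrite /expect.
rewrite (eq_integral (fun w => \sum_i ((init X i w)%:R ^+ 2)%:E)%E); last first.
  by move=> w _; rewrite sumEFin; congr _%:E; apply: eq_bigr => i _; rewrite ffunE.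
rewrite ge0_integral_sum //; first last.
all: try by move=> *; rewrite lee_fin exprn_ge0.
- move=> i; apply: (measurable_discrete_comp (fun n => (n%:R ^+ 2)%:E) (f := init X i)).
  by move=> n; exact: measurable_rv_preimage.
- apply: lte_sum_pinfty => i _.
  by have := init_square hmodel i; rewrite unlock.
Qed.

Lemma quad_le_sqr (l : R) n : 0 <= l -> quad l n <= n%:R ^+ 2.
Proof.
move=> l0; rewrite /quad; case: n => [|n]; first by rewrite expr0n /= mul0r mulr0 addr0.
have n1 : 1 <= n.+1%:R :> R by rewrite ler1n.
by nra.
Qed.

Lemma initial_lyapunov theta : 0 <= theta ->
  (E 0 (fun q => (lyapunov lam theta q)%:E) < +oo)%E.
Proof.
move=> t0; set c := 1 + theta * 2 ^+ size (index_enum 'I_N).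
have c0 : 0 <= c by rewrite addr_ge0 // mulr_ge0 // exprn_ge0.
have s0 (q : S) : 0 <= \sum_i (q i)%:R ^+ 2 :> R by apply: sumr_ge0 => i _; rewrite exprn_ge0.
apply: (@le_lt_trans _ _ (c%:E * E 0 (fun q => (\sum_i (q i)%:R ^+ 2)%:E))%E).
  rewrite -expectZ //; last by exact: discrete_chain.
  apply: expect_le; first exact: discrete_chain.
    by move=> q; rewrite lee_fin (lyapunov_ge0 hmodel) // ltW.
  move=> q; rewrite -EFinM lee_fin /lyapunov /c mulrDl mul1r lerD //.
    by apply: ler_sum => i _; apply: quad_le_sqr; exact: (arrival_rate_ge0 hmodel).
  rewrite -mulrA ler_wpM2l //; apply: le_trans (quad_le_sqr _ (lam_tot_ge0 hmodel)) _.
  rewrite natr_sum; exact: sqr_sum_le.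
rewrite lte_mul_pinfty //; exact: initial_second_moment.
Qed.

Local Notation rate := (departure_rate X g).
Local Notation mean i := (arithmetic_mean
  (fun t => fine (E t (fun q : S => ((q i)%:R)%:E)))).

Lemma lyapunov_empty theta : lyapunov lam theta empty = 0.
Proof.
rewrite /lyapunov [(\sum_i empty i)%N]big1; last by move=> i _; rewrite ffunE.
rewrite big1 => [|i _]; rewrite /quad ?ffunE; by rewrite expr0n /= mul0r mulr0 addr0 ?mulr0 ?addr0.
Qed.

(** The constant is the drift of the Lyapunov function at the empty state,
    where that function vanishes. *)
Lemma B_ge0 theta : 0 <= theta -> 0 <= B_ X lam theta.
Proof.
move=> t0; have := lyapunov_drift hmodel mg hg (ltW lam_lt1) empty t0.
rewrite lyapunov_empty add0r [(\sum_i empty i)%N]big1; last by move=> i _; rewrite ffunE.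
rewrite mul0r mulr0 addr0 big1 ?subr0 => [KE|i _]; last by rewrite ffunE mul0r.
rewrite -lee_fin -KE; apply: expect_ge0 => q.
by rewrite lee_fin (lyapunov_ge0 hmodel) // ltW.
Qed.

(** The chain is positive recurrent: the Foster-Lyapunov function combines the
    quadratic one, which decreases when the backlog is large, and [occupied],
    which decreases at all the other nonempty states. *)
Lemma backlog_average_cvg kappa : 0 < kappa ->
  (forall q : S, kappa * (total q)%:R
     <= \sum_i (q i)%:R * (rate q i - lam ord0 i)) ->
  forall i, (forall t, E t (fun q : S => ((q i)%:R)%:E) < +oo)%E /\
            cvgn (mean i).
Proof.
move=> k0 gain i.
pose B0 := B_ X lam 0; pose a := 2 / kappa.
have a0 : 0 <= a by rewrite divr_ge0 // ltW.
pose m := (Num.truncn (1 + a * B0)).+1.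
have hm : 1 + a * B0 <= m%:R by rewrite ltW // truncnS_gt.
pose b := m%:R / gamma ^+ m.
have gm0 : 0 < gamma ^+ m by rewrite exprn_gt0.
have b0 : 0 <= b by rewrite divr_ge0 // ltW.
pose V := lyapunov lam 0 : S -> R.
have V0 q : 0 <= V q by apply: (lyapunov_ge0 hmodel) => //; exact: ltW.
pose f0 (q : S) : \bar R := (1 + (total q)%:R)%:E.
pose H (q : S) : \bar R := (a%:E * (V q)%:E + b%:E * (occupied q)%:E)%E.
have aV0 q : (0 <= a%:E * (V q)%:E)%E by rewrite mule_ge0 ?lee_fin.
have bo0 q : (0 <= b%:E * (occupied q)%:E)%E by rewrite mule_ge0 ?lee_fin ?occupied_ge0.
have H0 q : (0 <= H q)%E by rewrite adde_ge0.
have o0 q : (0 <= (occupied q)%:E)%E by rewrite lee_fin occupied_ge0.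
have mN q := discrete_next X mg q.
have KV q : K (fun x => (V x)%:E) q = (V q + B0 - \sum_i (q i)%:R * (rate q i - lam ord0 i))%:E.
  by rewrite (lyapunov_drift hmodel mg hg (ltW lam_lt1)) // mul0r addr0.
have KH q : K H q = (a%:E * K (fun x => (V x)%:E) q + b%:E * K (fun x => (occupied x)%:E) q)%E.
  by rewrite /transition expectD // expectZ // expectZ.
(* Large backlogs are handled by [a * V], those with fewer than [m] packets by
   [b * occupied]. *)
have foster q : q != empty -> (f0 q + K H q <= H q)%E.
  move=> q0; rewrite KH KV /f0 /H; set n := total q; set D := \sum_i _.
  apply: (@le_trans _ _ ((1 + n%:R)%:E + (a%:E * (V q + B0 - D)%:E
      + b%:E * (occupied q - gamma ^+ n)%:E))%E).
    by rewrite leeD2l // leeD2l // lee_wpmul2l ?lee_fin // occupied_drift.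
  rewrite -!EFinM -!EFinD lee_fin.
  have hD : 2 * n%:R <= a * D.
    have := ler_wpM2l a0 (gain q).
    by rewrite mulrA {1}/a divfK // gt_eqF.
  have : 1 + a * B0 - n%:R <= b * gamma ^+ n.
    have [mn|nm] := leqP m n.
      apply: (@le_trans _ _ 0); last by rewrite mulr_ge0 // exprn_ge0 // ltW.
      by rewrite subr_le0 (le_trans hm) // ler_nat.
    apply: (@le_trans _ _ m%:R); first by rewrite lerBlDr ler_wpDr.
    rewrite -[leLHS](divfK (lt0r_neq0 gm0)) -/b ler_wpM2l //.
    by apply: ler_wiXn2l; [exact: ltW|exact: gamma_le1|exact: ltnW].
  move: hD; move: (V q) (occupied q) (gamma ^+ n) n%:R => v o y x.
  by clearbody a b B0 D => ? ?; lra.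
have occ_fin (f : T -> S) : discrete_rv f -> (expect P f (fun x => (occupied x)%:E) < +oo)%E.
  move=> mf; apply: (@le_lt_trans _ _ 1%E); last by rewrite ltry.
  rewrite -[leRHS](expect_cst P f); apply: expect_le => // x.
  by rewrite lee_fin occupied_le1.
have [] := @average_cost_cvg _ _ _ P S (next X g 0) (chain X g) empty mN
  (discrete_chain X mg) (chain_markov hmodel mg) f0 H _ H0 foster _ _
  (fun q => ((q i)%:R)%:E).
- by move=> q; rewrite lee_fin lerDl.
- have mc := @discrete_chain _ _ _ P N X g mg 0.
  rewrite expectD // expectZ // expectZ // lte_add_pinfty // lte_mul_pinfty ?lee_fin //.
    exact: initial_lyapunov.
  exact: occ_fin.
- by rewrite KH KV lte_add_pinfty // lte_mul_pinfty ?lee_fin ?ltry // occ_fin.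
- by move=> q; rewrite lee_fin.
- move=> q; rewrite lee_fin /total (bigD1 i) //= natrD addrA ler_wpDr // lerDr //.
- by rewrite ltry.
by [].
Qed.

(** The time average form of the drift inequality. *)
Lemma backlog_average_le theta kappa : 0 <= theta -> 0 < kappa ->
  (forall q : S, kappa * (total q)%:R
     <= \sum_i (q i)%:R * (rate q i - lam ord0 i)
        + theta * ((total q)%:R * (conn_prob p (level q 0) - lam_tot lam))) ->
  (forall i t, E t (fun q : S => ((q i)%:R)%:E) < +oo)%E ->
  (forall i, cvgn (mean i)) ->
  \sum_i limn (mean i) <= B_ X lam theta / kappa.
Proof.
move=> t0 k0 gain fin hcvg.
pose V := lyapunov lam theta : S -> R.
have V0 q : 0 <= V q by apply: (lyapunov_ge0 hmodel) => //; exact: ltW.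
set B := B_ X lam theta.
pose f (q : S) : \bar R := (kappa * (total q)%:R)%:E.
have f0 q : (0 <= f q)%E by rewrite lee_fin mulr_ge0 // ltW.
have drift q : (K (fun x => (V x)%:E) q + f q <= (V q)%:E + B%:E)%E.
  rewrite (lyapunov_drift hmodel mg hg (ltW lam_lt1)) // -!EFinD lee_fin.
  have := gain q; rewrite -/V -/B /total; lra.
have avg := @drift_average_le _ _ _ P S (next X g 0) (chain X g)
  (discrete_chain X mg) (chain_markov hmodel mg) (fun q => (V q)%:E) f B _ f0
  (B_ge0 t0) drift (initial_lyapunov t0).
have meanE n : arithmetic_mean (fun t => fine (E t f)) n = kappa * \sum_i mean i n.
  rewrite /arithmetic_mean /series /= -mulr_sumr mulrCA; congr (_ * _).
  rewrite exchange_big mulr_sumr /=; apply: eq_bigr => t _.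
  have mc := @discrete_chain _ _ _ P N X g mg t.
  have -> : E t f = (kappa%:E * \sum_i E t (fun q : S => ((q i)%:R)%:E))%E.
    rewrite /expect -ge0_integral_sum //; last first.
      by move=> i; exact: (measurable_discrete_comp (fun q : S => ((q i)%:R)%:E) mc).
    rewrite -ge0_integralZl ?lee_fin ?ltW //; first last.
    + by move=> w _; apply: sume_ge0 => i _; rewrite lee_fin.
    + apply: emeasurable_sum => i.
      exact: (measurable_discrete_comp (fun q : S => ((q i)%:R)%:E) mc).
    by apply: eq_integral => w _; rewrite sumEFin -natr_sum -EFinM.
  have Efin i : E t (fun q : S => ((q i)%:R)%:E) \is a fin_num.
    by rewrite ge0_fin_numE //; apply: expect_ge0 => q; rewrite lee_fin.
  rewrite (eq_bigr (fun i => (fine (E t (fun q : S => ((q i)%:R)%:E)))%:E)).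
    by rewrite sumEFin -EFinM.
  by move=> i _; rewrite fineK.
rewrite ler_pdivlMr // mulrC.
have lim1 : (fun n => kappa * \sum_i mean i n) @ \oo --> kappa * \sum_i limn (mean i).
  by apply: cvgMl_tmp; apply: cvg_big => [|i _]; [exact: add_continuous|exact: hcvg].
have lim2 : (fun n => fine (E 0 (fun q => (V q)%:E)) * n.+1%:R^-1 + B) @ \oo --> 0 + B.
  apply: cvgD; last exact: cvg_cst.
  rewrite -[X in _ --> X](mulr0 (fine (E 0 (fun q => (V q)%:E)))).
  by apply: cvgMl_tmp; exact: cvg_harmonic.
rewrite -[leRHS]add0r -(cvg_lim _ lim1) // -(cvg_lim _ lim2) //.
apply: ler_lim; [by apply/cvg_ex; eexists; exact: lim1|by apply/cvg_ex; eexists; exact: lim2|].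
by apply: nearW => n; rewrite -meanE; exact: avg.
Qed.

End LongestConnectedQueue.

(** * The delay bound *)

Section Conclusion.
Context (R : realType) (N : nat) (p : 'I_N -> R).

Lemma theta_ge0 rho K : 0 < pmin p < 1 -> (forall i, p i <= 1) -> rho < 1 ->
  (0 < K)%N -> 0 <= theta_ p rho K.
Proof.
move=> hp p1 rho1 K0; rewrite /theta_; case: ifP => // KN.
apply: divr_ge0; last by apply: ltW; exact: r_gt0.
apply: mulr_ge0; rewrite subr_ge0; first exact: ltW.
by apply: mu_sym_decr => //; exact: ltnW.
Qed.

End Conclusion.

Theorem theorem2 (R : realType) (d : measure_display) (T : measurableType d)
    (P : probability T R) (N : nat) (X : onoff_processes P N)
    (lam : 'rV[R]_N) (p : 'I_N -> R) (sel : nat -> T -> option 'I_N)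
    (rho : R) (K : nat)
    (hN : (0 < N)%N)
    (hmodel : onoff_model X lam p)
    (hpmin : 0 < pmin p < 1)
    (hLCQ : LCQ X sel)
    (hrho : 0 < rho < 1)
    (hlam : [set rho *: x | x in capacity_region p] lam)
    (hK : (0 < K)%N)
    (hrK : lam_tot lam < r_ p K.+1) :
  [/\ forall i, strongly_stable X sel i,
      forall i, cvgn (avg_backlog X sel i),
      (\sum_(i < N) Qbar X sel i
         <= (K%:R * B_ X lam (theta_ p rho K) * C_ p lam rho K
             / (1 - rho) ^+ 2)%:E)%E &
      0 < lam_tot lam ->
      (Wbar X sel lam
         <= (Num.min
               (K%:R * B_ X lam (theta_ p rho K) * C_ p lam rho K
                / (lam_tot lam * (1 - rho) ^+ 2))
               (N%:R * B_ X lam 0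
                / (lam_tot lam * r_ p N * (1 - rho))))%:E)%E].
Proof.
have [rho0 rho1] := andP hrho; have [pmin0 _] := andP hpmin.
have p1 := chan_prob_le1 hmodel.
have p0 i : 0 < p i by exact: lt_le_trans pmin0 (pmin_le p i).
have lam0 := arrival_rate_ge0 hmodel.
have lamL (L : {set 'I_N}) : \sum_(i in L) lam ord0 i <= rho * conn_prob p L.
  case: hlam => x hx <-; under eq_bigr do rewrite mxE.
  by rewrite -mulr_sumr ler_pM2l // capacity_region_le.
have lam1 : lam_tot lam < 1 by exact: lt_le_trans hrK (r_le1 hpmin _).
case: hLCQ => g [mg hg selE].
have stateE t w : chain X g t w = state_at X sel t w.
  elim: t => [|t IH]; first by apply/ffunP => i; rewrite !ffunE.
  by apply/ffunP => i; rewrite /= /next !ffunE IH !ffunE /= selE (inj_eq Some_inj).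
pose mean i := arithmetic_mean (fun t =>
  fine (expect P (chain X g t) (fun q : {ffun 'I_N -> nat} => ((q i)%:R)%:E))).
have rateE (q : {ffun 'I_N -> nat}) :
    \sum_i (q i)%:R * (departure_rate X g q i - lam ord0 i) =
    \sum_(0 <= m < \sum_i q i) conn_prob p (level q m)
    - \sum_i (q i)%:R * lam ord0 i.
  rewrite -(departure_rate_weighted_sum hmodel mg hg) -sumrB.
  by apply: eq_bigr => i _; rewrite mulrBr.
have k0 : 0 < (1 - rho) * mu_sym p N by rewrite mulr_gt0 ?mu_sym_gt0 ?subr_gt0.
have gain0 (q : {ffun 'I_N -> nat}) : (1 - rho) * mu_sym p N * (total q)%:R
    <= \sum_i (q i)%:R * (departure_rate X g q i - lam ord0 i).
  by rewrite rateE; exact: level_sum_gain0.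
have avg := backlog_average_cvg hmodel mg hg p0 lam1 k0 gain0.
have fin i t := (avg i).1 t.
have mcvg i : cvgn (mean i) := (avg i).2.
have avgE i n : avg_backlog X sel i n.+1 = (mean i n)%:E.
  rewrite /avg_backlog EFinM /=; congr (_ * _)%E; rewrite /series /= -sumEFin.
  apply: eq_bigr => t _; rewrite fineK.
    by rewrite unlock; apply: eq_integral => w _; rewrite stateE ffunE.
  by rewrite ge0_fin_numE //; apply: expect_ge0 => q; rewrite lee_fin.
have avgcvg i : avg_backlog X sel i @ \oo --> (limn (mean i))%:E.
  rewrite -(cvg_shiftS (avg_backlog X sel i)) /=.
  rewrite (_ : (fun n => _) = EFin \o mean i); last by apply/funext => n; exact: avgE.
  by apply: cvg_EFin; [exact: nearW | exact: mcvg].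
have QbarE : (\sum_(i < N) Qbar X sel i = (\sum_i limn (mean i))%:E)%E.
  by rewrite -sumEFin; apply: eq_bigr => i _; exact: cvg_lim.
(* The case of the weight 0, which also serves when [N <= K]. *)
have bound0 : \sum_i limn (mean i) <= B_ X lam 0 / ((1 - rho) * mu_sym p N).
  apply: (backlog_average_le hmodel mg hg) => // q.
  by rewrite mul0r addr0; exact: gain0.
have B0 : 0 <= B_ X lam 0 by exact: (B_ge0 hmodel mg hg).
have rN0 : 0 < r_ p N by exact: r_gt0.
have N0 : 0 < N%:R :> R by rewrite ltr0n.
have rho1' : 0 < 1 - rho by rewrite subr_gt0.
have bound : \sum_i limn (mean i) <=
    K%:R * B_ X lam (theta_ p rho K) * C_ p lam rho K / (1 - rho) ^+ 2.
  have [KN|NK] := ltnP K N.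
    rewrite C_gain //; apply: (backlog_average_le hmodel mg hg) => //.
    - exact: theta_ge0.
    - exact: gain_gt0.
    - by move=> q; rewrite rateE; exact: level_sum_theta_gain.
  apply: le_trans bound0 _; rewrite /theta_ /C_ ltnNge NK /=.
  have -> : B_ X lam 0 / ((1 - rho) * mu_sym p N)
      = N%:R * (1 - rho) * (B_ X lam 0 / r_ p N / (1 - rho) ^+ 2).
    by rewrite /mu_sym; field; rewrite !gt_eqF.
  have -> : K%:R * B_ X lam 0 / r_ p N / (1 - rho) ^+ 2
      = K%:R * (B_ X lam 0 / r_ p N / (1 - rho) ^+ 2) by rewrite !mulrA.
  apply: ler_wpM2r.
    by apply: divr_ge0; rewrite ?exprn_ge0 ?divr_ge0 //; exact: ltW.
  apply: (@le_trans _ _ N%:R); last by rewrite ler_nat.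
  by rewrite ger_pMr // gerBl ltW.
split=> [i|i||lam_gt0].
- rewrite /strongly_stable.
  have [_ ->] := cvg_limn_einf_sup (avgcvg i); exact: ltry.
- by apply/cvg_ex; eexists; exact: avgcvg.
- by rewrite QbarE lee_fin.
rewrite /Wbar QbarE -EFinM lee_fin le_min; apply/andP; split.
  rewrite ler_pdivrMl //; apply: le_trans bound _.
  by rewrite le_eqVlt; apply/orP; left; apply/eqP; field; rewrite !gt_eqF.
rewrite ler_pdivrMl //; apply: le_trans bound0 _.
rewrite le_eqVlt; apply/orP; left; apply/eqP.
by rewrite /mu_sym; field; rewrite !gt_eqF.
Qed.
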